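(* Let $\varphi\in\mathcal O(\mathbb D^2,\mathbb D)$ extend to a $\mathcal C^3$-smooth function on $\overline{\mathbb D^2}$. Assume there exists $\xi\in\mathbb T^2$ with $\varphi(\xi)\in\mathbb T$ such that $\varphi$ is truly two-dimensional at $\xi$ of order $2$. Then there exist a neighbourhood $\mathcal U$ of $\xi$ and $C>0$ such that for all $\beta\in(-1,0]$, all $\eta\in\mathbb T$ and all $\delta>0$, $$V_\beta\big(\{z\in\mathbb D^2\cap\mathcal U:\ |\varphi(z)-\eta|<\delta\}\big)\le C\delta^{2+\beta+\frac12}.$$
   Context: $dA$ is the normalized area measure on $\mathbb D$; $dA_\beta(z)=(\beta+1)(1-|z|^2)^\beta dA(z)$; $dV_\beta=dA_\beta(z_1)dA_\beta(z_2)$. For $\varphi\in\mathcal O(\mathbb D^2,\mathbb D)\cap\mathcal C^2(\overline{\mathbb D^2})$ and $\xi=(e^{i\alpha_1},e^{i\alpha_2})\in\mathbb T^2$ with $\varphi(\xi)\in\mathbb T$, set $\psi(\theta)=\overline{\varphi(\xi)}\varphi(e^{i(\alpha_1+\theta_1)},e^{i(\alpha_2+\theta_2)})$, $\theta\in\mathbb R^2$. We say $\varphi$ is truly two-dimensional at $\xi$ of order $2$ if, writing $\mathrm{Re}\,\psi(\theta)=1-Q(\theta)+o(|\theta|^2)$ with $Q$ a real quadratic form, $Q$ has signature $(2,0)$ (i.e. is positive definite). *)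

(* Defs.v *)
From HB Require Import structures.
From mathcomp Require Import all_boot order all_algebra.
From mathcomp Require Import all_classical all_reals all_analysis.
Import Order.TTheory GRing.Theory Num.Theory.
Import numFieldNormedType.Exports.
Set Implicit Arguments. Unset Strict Implicit. Unset Printing Implicit Defensive.
Local Open Scope ring_scope.
Local Open Scope classical_set_scope.

Section Defs.
Variable R : realType.

Definition cplx := (R * R)%type.
Definition cplx2 := (cplx * cplx)%type.

Definition cmul (a b : cplx) : cplx := (a.1 * b.1 - a.2 * b.2, a.1 * b.2 + a.2 * b.1).
Definition cconj (a : cplx) : cplx := (a.1, - a.2).
Definition cabs (a : cplx) : R := Num.sqrt (a.1 ^+ 2 + a.2 ^+ 2).
Definition csub (a b : cplx) : cplx := (a.1 - b.1, a.2 - b.2).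
Definition expi (t : R) : cplx := (cos t, sin t).
Definition cJ (a : cplx) : cplx := (- a.2, a.1).
Definition cJ2 (z : cplx2) : cplx2 := (cJ z.1, cJ z.2).

Definition disc : set cplx := [set a | cabs a < 1].
Definition circle : set cplx := [set a | cabs a = 1].
Definition bidisc : set cplx2 := [set z | disc z.1 /\ disc z.2].
Definition cl_bidisc : set cplx2 := [set z | cabs z.1 <= 1 /\ cabs z.2 <= 1].

(* holomorphy on the open bidisc: real Frechet differentiable with a
   C-linear differential (i.e. complex differentiable). *)
Definition holomorphic_on (A : set cplx2) (f : cplx2 -> cplx) : Prop :=
  forall z, A z -> differentiable f z /\ forall h, 'd f z (cJ2 h) = cJ ('d f z h).

Fixpoint smooth_Ck {V W : normedModType R} (k : nat) (f : V -> W) : Prop :=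
  match k with
  | 0 => continuous f
  | k'.+1 => (forall x, differentiable f x) /\
             forall v : V, smooth_Ck k' (fun x => 'D_v f x)
  end.

Definition Ck_up_to_boundary (k : nat) (f : cplx2 -> cplx) : Prop :=
  exists F : cplx2 -> cplx, smooth_Ck k F /\ {in cl_bidisc, F =1 f}.

Definition psi (f : cplx2 -> cplx) (a1 a2 : R) (t : R * R) : cplx :=
  cmul (cconj (f (expi a1, expi a2))) (f (expi (a1 + t.1), expi (a2 + t.2))).

Definition qform (a b c : R) (t : R * R) : R :=
  a * t.1 ^+ 2 + 2 * b * t.1 * t.2 + c * t.2 ^+ 2.

Definition truly_2d_order2 (f : cplx2 -> cplx) (a1 a2 : R) : Prop :=
  exists a b c : R,
    (forall eps : R, 0 < eps ->
       \forall t \near (0 : R * R),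
         `| (psi f a1 a2 t).1 - (1 - qform a b c t) | <= eps * `|t| ^+ 2)
    /\ (forall t : R * R, t != 0 -> 0 < qform a b c t).

Definition leb2 := ((@lebesgue_measure R) \x (@lebesgue_measure R))%E.
Definition leb4 := (leb2 \x leb2)%E.

(* dA_beta density w.r.t. Lebesgue measure on C (dA = dx dy / pi) *)
Definition dens_beta (beta : R) (a : cplx) : R :=
  (beta + 1) / pi * (1 - cabs a ^+ 2) `^ beta.

Definition V_beta (beta : R) (S : set cplx2) : \bar R :=
  (\int[leb4]_(z in S) (dens_beta beta z.1 * dens_beta beta z.2)%:E)%E.

End Defs.

(* Main.v *)
Require Import Defs.
From HB Require Import structures.
From mathcomp Require Import all_boot order all_algebra.
From mathcomp Require Import all_classical all_reals all_analysis.
From mathcomp Require Import measurable_realfun.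
From mathcomp Require Import ring lra.
Import Order.TTheory GRing.Theory Num.Theory.
Import numFieldNormedType.Exports.
Set Implicit Arguments. Unset Strict Implicit. Unset Printing Implicit Defensive.
Local Open Scope ring_scope.
Local Open Scope classical_set_scope.

(** In logarithmic coordinates z_j = exp(- rho_j + i (alpha_j + theta_j)) the function
    Phi(rho, theta) = F(z), F being the smooth extension of phi, satisfies the
    Cauchy-Riemann equations for rho > 0, hence, by symmetry of second derivatives and
    continuity, it is harmonic in each (rho_j, theta_j) to second order at the origin.
    Write g_eta = Re (conj eta Phi) <= 1.  On the torus rho = 0 the Hessian of g_eta at the
    origin is -2Q for eta = phi(xi); since it is negative definite, harmonicity makes g_eta
    convex in rho_j, and because g_eta is maximal at the origin its rho_j-derivative there is
    negative.  For eta close to phi(xi) and two points of {|phi - eta| < delta} near xi: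
    - moving to the torus increases g_eta at a linear rate, so rho_j = O(delta);
    - uniform concavity of g_eta in theta, tested at the midpoint, where g_eta <= 1, bounds
      the distance of the angles by O(sqrt delta);
    - Phi is bi-Lipschitz in the second variable, so over a fixed z1 the values of z2 lie in
      a ball of radius O(delta).
    Integrating the density first over z2 (O(delta)), then over a cap of depth O(delta) and
    width O(sqrt delta) in z1 (O(delta^(beta+1) sqrt delta)) gives the exponent. *)

(** * Smooth functions *)

(** The obstacle is that all the information sits at a boundary point, while holomorphy is available
    only inside the bidisc: the hypothesis on [Q] controls tangential second derivatives alone, and
    harmonicity, obtained at the origin as a limit from the interior, is what turns it into radial
    information. Two points of the set are compared with each other, never with a maximum point of
    [g_eta]: for [eta] different from [phi(xi)] the value 1 need not be attained nearby, but
    [g_eta <= 1] always holds, and this is enough for a diameter bound. Closeness of [eta] to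
    [phi(xi)] costs nothing: near [xi] it follows from [|phi(z) - eta| < delta] when [delta] is
    small, and when [delta] is bounded below the bounds on depth and width hold trivially with a
    larger constant, the neighbourhood being bounded. Uniformity in [beta] comes from the factor
    [beta + 1] of the density, which cancels the [1 / (beta + 1)] produced by integrating
    [t^beta]. *)

Lemma is_derive_line (R : realType) (V : normedModType R) (g : V -> R) (x v : V) (t : R) :
  differentiable g (x + t *: v) ->
  is_derive t 1 (fun s => g (x + s *: v)) ('D_v g (x + t *: v)).
Proof.
move=> dg.
have dl : is_diff t (fun s : R => x + s *: v) (fun s : R => s *: v).
  have -> : (fun s : R => x + s *: v) = cst x + ( *:%R ^~ v) by [].
  by apply: is_diff_eq; rewrite add0r.
have dgl : is_diff t (fun s => g (x + s *: v)) ('d g (x + t *: v) \o ( *:%R ^~ v)).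
  exact: (is_diff_comp dl (differentiableP dg)).
have df : differentiable (fun s : R => g (x + s *: v)) t by apply: ex_diff.
apply: (@DeriveDef _ _ _ _ _ _ _ (diff_derivable df)).
by rewrite deriveE// diff_val /= scale1r deriveE.
Qed.

Lemma mean_value_line (R : realType) (V : normedModType R) (g : V -> R) (x v : V) :
  (forall y, differentiable g y) ->
  exists2 c : R, 0 < c < 1 & g (x + v) - g x = 'D_v g (x + c *: v).
Proof.
move=> dg.
have dgl (t : R) : is_derive t 1 (fun s => g (x + s *: v)) ('D_v g (x + t *: v)).
  exact: is_derive_line.
pose G := fun s : R => g (x + s *: v).
have cG : {within `[0, 1], continuous G}.
  by apply: derivable_within_continuous => t _; have [] := dgl t.
have [c] := MVT ltr01 (fun t _ => dgl t) cG.
rewrite in_itv/= /G scale1r scale0r addr0 subr0 mulr1 => c01 E.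
by exists c.
Qed.

Section Smooth.
Context {R : realType}.
Implicit Types V W Z : normedModType R.

Lemma smooth_continuous {V W} k (f : V -> W) : smooth_Ck k f -> continuous f.
Proof.
by case: k => [//|k] [df _] x; exact: differentiable_continuous.
Qed.

Lemma smoothW {V W} k (f : V -> W) : smooth_Ck k.+1 f -> smooth_Ck k f.
Proof.
elim: k f => [f|k IH f [df Df]]; first exact: smooth_continuous.
by split=> // v; exact: IH.
Qed.

Lemma smooth_cst {V W} k (a : W) : smooth_Ck k (fun _ : V => a).
Proof.
elim: k a => [a|k IH a]; first by move=> x; exact: cvg_cst.
split=> [x|v]; first exact: differentiable_cst.
suff -> : (fun x : V => 'D_v (fun _ : V => a) x) = fun=> 0 by exact: IH.
by apply/funext => x; exact: derive_cst.
Qed.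

Lemma smoothD {V W} k (f g : V -> W) :
  smooth_Ck k f -> smooth_Ck k g -> smooth_Ck k (fun x => f x + g x).
Proof.
elim: k f g => [f g cf cg x|k IH f g [df Df] [dg Dg]].
  by apply: cvgD; [exact: cf|exact: cg].
split=> [x|v]; first exact: (differentiableD (df x) (dg x)).
suff -> : (fun x => 'D_v (fun x => f x + g x) x) = fun x => 'D_v f x + 'D_v g x.
  exact: (IH _ _ (Df v) (Dg v)).
by apply/funext => x; rewrite -deriveD//; exact: diff_derivable.
Qed.

Lemma smoothM {V} k (f g : V -> R) :
  smooth_Ck k f -> smooth_Ck k g -> smooth_Ck k (fun x => f x * g x).
Proof.
elim: k f g => [f g cf cg x|k IH f g sf sg].
  by apply: cvgM; [exact: cf|exact: cg].
have [[df Df] [dg Dg]] := (sf, sg).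
split=> [x|v]; first exact: (differentiableM (df x) (dg x)).
suff -> : (fun x => 'D_v (fun x => f x * g x) x) = fun x => f x * 'D_v g x + g x * 'D_v f x.
  refine (smoothD (IH _ _ (smoothW sf) (Dg v)) (IH _ _ (smoothW sg) (Df v))).
by apply/funext => x; rewrite -deriveM//; exact: diff_derivable.
Qed.

Lemma smooth_comp_linear {V W Z} k (L : {linear W -> Z}) (f : V -> W) :
  continuous L -> smooth_Ck k f -> smooth_Ck k (fun x => L (f x)).
Proof.
move=> cL; elim: k f => [f cf x|k IH f [df Df]].
  by apply: continuous_comp; [exact: cf|exact: cL].
have dLf x : differentiable (L \o f) x.
  by apply: differentiable_comp => //; exact: linear_differentiable.
split=> // v.
suff -> : (fun x => 'D_v (fun x => L (f x)) x) = fun x => L ('D_v f x).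
  exact: (IH _ (Df v)).
apply/funext => x; rewrite [LHS](deriveE _ (dLf x)) diff_comp//; last exact: linear_differentiable.
by rewrite /= diff_lin// deriveE.
Qed.

Lemma smooth_fst {V W Z} k (f : V -> W * Z) : smooth_Ck k f -> smooth_Ck k (fun x => (f x).1).
Proof. by move=> /(@smooth_comp_linear _ _ _ k (@fst W Z)); apply=> x; exact: cvg_fst. Qed.

Lemma smooth_snd {V W Z} k (f : V -> W * Z) : smooth_Ck k f -> smooth_Ck k (fun x => (f x).2).
Proof. by move=> /(@smooth_comp_linear _ _ _ k (@snd W Z)); apply=> x; exact: cvg_snd. Qed.

End Smooth.

Section Smooth2.
Context {R : realType}.
Implicit Types V W Z : normedModType R.

Lemma smooth_id {V} k : smooth_Ck k (@id V).
Proof.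
case: k => [x|k]; first exact: cvg_id.
split=> [x|v]; first exact: ex_diff.
suff -> : (fun x => 'D_v (@id V) x) = fun=> v by exact: smooth_cst.
by apply/funext => x; exact: derive_id.
Qed.

Lemma chain_real {V} (h : R -> R) (u : V -> R) (x v : V) (dh : R) :
  differentiable u x -> is_derive (u x) 1 h dh ->
  differentiable (fun y => h (u y)) x /\ 'D_v (fun y => h (u y)) x = 'D_v u x * dh.
Proof.
move=> du dhx.
have dhd : differentiable h (u x) by apply/derivable1_diffP; case: dhx.
have dc : differentiable (h \o u) x by exact: differentiable_comp.
split; first exact: dc.
rewrite (deriveE v dc) diff_comp//= [in RHS]deriveE//.
have -> : 'd h (u x) = ( *:%R^~ (h^`() (u x))) :> (R -> R).
  by apply: deriv1E; case: dhx.
by rewrite derive1E (@derive_val _ _ _ _ _ _ _ dhx).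
Qed.

(** Induction on [k] replaces [h] by its derivative, so it must run over a family [P] stable under
    differentiation: the singleton of [expR], or the span of [cos] and [sin]. *)
Lemma smooth_comp_real {V} k (P : set (R -> R)) (h : R -> R) (u : V -> R) :
  (forall f, P f -> exists2 g, P g & forall x : R, is_derive x 1 f (g x)) ->
  P h -> smooth_Ck k u -> smooth_Ck k (fun x => h (u x)).
Proof.
move=> HP; elim: k h u => [h u Ph cu x|k IH h u Ph su].
  have [g _ dh] := HP _ Ph.
  apply: (@continuous_comp _ _ _ u h); first exact: cu.
  by apply: differentiable_continuous; apply/derivable1_diffP; case: (dh (u x)).
have [g Pg dh] := HP _ Ph.
have [du Du] := su.
split=> [x|v]; first by have [] := @chain_real _ h u x 0 _ (du x) (dh (u x)).
suff -> : (fun x => 'D_v (fun y => h (u y)) x) = fun x => 'D_v u x * g (u x).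
  exact: (smoothM (Du v) (IH _ _ Pg (smoothW su))).
by apply/funext => x; have [_] := @chain_real _ h u x v _ (du x) (dh (u x)).
Qed.

Lemma smooth_expR {V} k (u : V -> R) : smooth_Ck k u -> smooth_Ck k (fun x => expR (u x)).
Proof.
apply: (@smooth_comp_real _ _ [set expR]) => // f ->.
by exists expR => // x; exact: is_derive_expR.
Qed.

Let trig : set (R -> R) := [set f | exists a b, f = fun x => a * cos x + b * sin x].

Let trig_closed f : trig f -> exists2 g, trig g & forall x : R, is_derive x 1 f (g x).
Proof.
move=> [a [b ->]]; exists (fun x => b * cos x + (- a) * sin x); first by exists b, (- a).
move=> x; have dc := is_derive_cos x; have ds := is_derive_sin x.
have -> : (fun y : R => a * cos y + b * sin y) = a *: (@cos R) + b *: (@sin R) by [].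
by apply: is_derive_eq; rewrite /GRing.scale /=; ring.
Qed.

Lemma smooth_cos {V} k (u : V -> R) : smooth_Ck k u -> smooth_Ck k (fun x => cos (u x)).
Proof.
apply: (smooth_comp_real trig_closed); exists 1, 0.
by apply/funext => x; rewrite mul1r mul0r addr0.
Qed.

Lemma smooth_sin {V} k (u : V -> R) : smooth_Ck k u -> smooth_Ck k (fun x => sin (u x)).
Proof.
apply: (smooth_comp_real trig_closed); exists 0, 1.
by apply/funext => x; rewrite mul1r mul0r add0r.
Qed.

(** In logarithmic coordinates [e11] and [e21] are the radial directions [rho_1], [rho_2], while
    [e12] and [e22] are the angular directions [theta_1], [theta_2]. *)
Definition e11 : cplx2 R := ((1, 0), (0, 0)).
Definition e12 : cplx2 R := ((0, 1), (0, 0)).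
Definition e21 : cplx2 R := ((0, 0), (1, 0)).
Definition e22 : cplx2 R := ((0, 0), (0, 1)).

Lemma cplx2_coord (v : cplx2 R) :
  v = v.1.1 *: e11 + v.1.2 *: e12 + v.2.1 *: e21 + v.2.2 *: e22.
Proof.
case: v => [[a b] [c d]].
by apply: injective_projections; apply: injective_projections;
  rewrite /= /GRing.scale /= !(mulr0, mulr1, addr0, add0r).
Qed.

Lemma derive_coord (H : cplx2 R -> R) (x v : cplx2 R) : differentiable H x ->
  'D_v H x = v.1.1 * 'D_e11 H x + v.1.2 * 'D_e12 H x
           + v.2.1 * 'D_e21 H x + v.2.2 * 'D_e22 H x.
Proof. by move=> dH; rewrite !deriveE// {1}(cplx2_coord v) !linearD !linearZ. Qed.

End Smooth2.

Section Smooth3.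
Context {R : realType}.
Implicit Types V W Z : normedModType R.

Lemma smooth_pair {V W Z} k (f : V -> W) (g : V -> Z) :
  smooth_Ck k f -> smooth_Ck k g -> smooth_Ck k (fun x => (f x, g x)).
Proof.
elim: k f g => [f g cf cg x|k IH f g [df Df] [dg Dg]].
  by apply: cvg_pair; [exact: cf|exact: cg].
have dfg x : differentiable (fun x => (f x, g x)) x by exact: differentiable_pair.
split=> [//|v].
suff -> : (fun x => 'D_v (fun x => (f x, g x)) x) = fun x => ('D_v f x, 'D_v g x).
  exact: (IH _ _ (Df v) (Dg v)).
by apply/funext => x; rewrite deriveE// diff_pair// !deriveE.
Qed.

(** The chain rule differentiates [H] in the direction ['D_v E x], which moves with [x]. Expanding
    it in the four fixed directions leaves the functions ['D_e H], to which the induction hypothesis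
    applies. *)
Lemma smooth_comp_cplx2 {V} k (H : cplx2 R -> R) (E : V -> cplx2 R) :
  smooth_Ck k E -> smooth_Ck k H -> smooth_Ck k (fun x => H (E x)).
Proof.
elim: k H => [H cE cH x|k IH H sE sH].
  by apply: (@continuous_comp _ _ _ E H); [exact: cE|exact: cH].
have [[dE DE] [dH DH]] := (sE, sH).
have dHE x : differentiable (H \o E) x by exact: differentiable_comp.
split=> [//|v].
pose D := 'D_v E.
suff -> : (fun x => 'D_v (fun x => H (E x)) x) = fun x =>
   (D x).1.1 * 'D_e11 H (E x) + (D x).1.2 * 'D_e12 H (E x)
 + (D x).2.1 * 'D_e21 H (E x) + (D x).2.2 * 'D_e22 H (E x).
  have D1 := smooth_fst (DE v); have D2 := smooth_snd (DE v).
  have IH' u := IH _ (smoothW sE) (DH u).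
  have S11 := smoothM (smooth_fst D1) (IH' e11).
  have S12 := smoothM (smooth_snd D1) (IH' e12).
  have S21 := smoothM (smooth_fst D2) (IH' e21).
  have S22 := smoothM (smooth_snd D2) (IH' e22).
  exact: (smoothD (smoothD (smoothD S11 S12) S21) S22).
apply/funext => x; rewrite -derive_coord//.
by rewrite [LHS](deriveE v (dHE x)) diff_comp//= deriveE// /D deriveE.
Qed.

Lemma cplx2_norm_coord (v : cplx2 R) :
  [/\ `|v.1.1| <= `|v|, `|v.1.2| <= `|v|, `|v.2.1| <= `|v| & `|v.2.2| <= `|v|].
Proof.
have h (W Z : normedModType R) (u : W * Z) : `|u.1| <= `|u| /\ `|u.2| <= `|u|.
  by rewrite prod_normE !le_max !lexx orbT.
have [a b] := h _ _ v; have [c d] := h _ _ v.1; have [e f] := h _ _ v.2.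
by split; [exact: le_trans c a|exact: le_trans d a|exact: le_trans e b|exact: le_trans f b].
Qed.

Lemma norm_sum4 (c1 c2 c3 c4 d1 d2 d3 d4 m e : R) :
  [/\ `|c1| <= m, `|c2| <= m, `|c3| <= m & `|c4| <= m] ->
  [/\ `|d1| <= e, `|d2| <= e, `|d3| <= e & `|d4| <= e] ->
  `|c1 * d1 + c2 * d2 + c3 * d3 + c4 * d4| <= 4 * (m * e).
Proof.
move=> [m1 m2 m3 m4] [e1 e2 e3 e4].
have h c d : `|c| <= m -> `|d| <= e -> `|c * d| <= m * e.
  by move=> ? ?; rewrite normrM ler_pM.
rewrite (_ : 4 * _ = m * e + m * e + m * e + m * e); last by ring.
do 3!(apply: (le_trans (ler_normD _ _)); rewrite lerD ?h//).
Qed.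

Lemma norm_sum4B (c1 c2 c3 c4 d1 d2 d3 d4 f1 f2 f3 f4 m e : R) :
  [/\ `|c1| <= m, `|c2| <= m, `|c3| <= m & `|c4| <= m] ->
  [/\ `|d1 - f1| <= e, `|d2 - f2| <= e, `|d3 - f3| <= e & `|d4 - f4| <= e] ->
  `|(c1 * d1 + c2 * d2 + c3 * d3 + c4 * d4) - (c1 * f1 + c2 * f2 + c3 * f3 + c4 * f4)|
    <= 4 * (m * e).
Proof.
move=> hc hd; rewrite (_ : _ - _ = c1 * (d1 - f1) + c2 * (d2 - f2) + c3 * (d3 - f3) + c4 * (d4 - f4)).
  exact: norm_sum4.
by ring.
Qed.

(** Uniformity in [v] is a finite-dimensional effect: ['D_v H] combines four continuous partial
    derivatives with coefficients at most [|v|], hence the tolerance [eps / 4] on each. *)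
Lemma derive_near_unif (H : cplx2 R -> R) (x : cplx2 R) (eps : R) : smooth_Ck 1 H ->
  0 < eps -> \forall y \near x, forall v, `|'D_v H y - 'D_v H x| <= eps * `|v|.
Proof.
move=> [dH DH] eps0.
have e40 : 0 < eps / 4 by rewrite divr_gt0.
have n u : \forall y \near x, `|'D_u H y - 'D_u H x| <= eps / 4.
  have := DH u x => /cvgrPdist_le /(_ _ e40).
  by apply: filterS => y; rewrite distrC.
have N := filterI (filterI (n e11) (n e12)) (filterI (n e21) (n e22)).
apply: (filterS _ (N _ _ _)) => y [[h1 h2] [h3 h4]] v.
rewrite (derive_coord v (dH y)) (derive_coord v (dH x)).
have -> : eps * `|v| = 4 * (`|v| * (eps / 4)) by field.
exact: norm_sum4B (cplx2_norm_coord v) (And4 h1 h2 h3 h4).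
Qed.

Lemma le_sum4 (a b c d : R) : 0 <= a -> 0 <= b -> 0 <= c -> 0 <= d ->
  [/\ a <= a + b + c + d, b <= a + b + c + d, c <= a + b + c + d & d <= a + b + c + d].
Proof. by split; lra. Qed.

Lemma derive_bounded (H : cplx2 R -> R) (x : cplx2 R) : differentiable H x ->
  exists2 M, 0 <= M & forall v, `|'D_v H x| <= M * `|v|.
Proof.
move=> dH.
pose e := `|'D_e11 H x| + `|'D_e12 H x| + `|'D_e21 H x| + `|'D_e22 H x|.
exists (4 * e); first by rewrite mulr_ge0// !addr_ge0.
move=> v; rewrite derive_coord// -mulrA [e * _]mulrC.
apply: norm_sum4; first exact: cplx2_norm_coord.
by apply: le_sum4; exact: normr_ge0.
Qed.

Lemma derive_lincomb4 {V} (c1 c2 c3 c4 : R) (f1 f2 f3 f4 : V -> R) (x u : V) :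
  differentiable f1 x -> differentiable f2 x -> differentiable f3 x -> differentiable f4 x ->
  'D_u (fun y => c1 * f1 y + c2 * f2 y + c3 * f3 y + c4 * f4 y) x =
  c1 * 'D_u f1 x + c2 * 'D_u f2 x + c3 * 'D_u f3 x + c4 * 'D_u f4 x.
Proof.
move=> d1 d2 d3 d4.
have [h1 h2 h3 h4] : [/\ derivable f1 x u, derivable f2 x u, derivable f3 x u & derivable f4 x u].
  by split; exact: diff_derivable.
have -> : (fun y => c1 * f1 y + c2 * f2 y + c3 * f3 y + c4 * f4 y) =
  c1 *: f1 + c2 *: f2 + c3 *: f3 + c4 *: f4 by [].
have k1 : derivable (c1 *: f1) x u by exact: derivableZ.
have k2 : derivable (c2 *: f2) x u by exact: derivableZ.
have k3 : derivable (c3 *: f3) x u by exact: derivableZ.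
have k4 : derivable (c4 *: f4) x u by exact: derivableZ.
have k12 := derivableD k1 k2; have k123 := derivableD k12 k3.
rewrite (deriveD k123 k4) (deriveD k12 k3) (deriveD k1 k2).
by rewrite (deriveZ c1 h1) (deriveZ c2 h2) (deriveZ c3 h3) (deriveZ c4 h4).
Qed.

Lemma derive2_coord (H : cplx2 R -> R) (x v u : cplx2 R) : smooth_Ck 2 H ->
  'D_u ('D_v H) x = v.1.1 * 'D_u ('D_e11 H) x + v.1.2 * 'D_u ('D_e12 H) x
           + v.2.1 * 'D_u ('D_e21 H) x + v.2.2 * 'D_u ('D_e22 H) x.
Proof.
move=> [dH DH].
have E : 'D_v H = fun y => v.1.1 * 'D_e11 H y + v.1.2 * 'D_e12 H y
           + v.2.1 * 'D_e21 H y + v.2.2 * 'D_e22 H y.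
  by apply/funext => y; exact: (derive_coord v (dH y)).
apply: (etrans (congr1 (fun f : cplx2 R -> R => 'D_u f x) E)).
exact: (@derive_lincomb4 _ v.1.1 v.1.2 v.2.1 v.2.2 ('D_e11 H) ('D_e12 H) ('D_e21 H)
  ('D_e22 H) x u ((DH e11).1 x) ((DH e12).1 x) ((DH e21).1 x) ((DH e22).1 x)).
Qed.

Lemma normB_eq_le (p q p' q' b : R) : p = p' -> q = q' -> `|p' - q'| <= b -> `|p - q| <= b.
Proof. by move=> -> ->. Qed.

(** One factor [|v|] comes from expanding the inner derivative in coordinates, the other from the
    first-order statement applied to each partial derivative. *)
Lemma derive2_near_unif (H : cplx2 R -> R) (x : cplx2 R) (eps : R) : smooth_Ck 2 H ->
  0 < eps -> \forall y \near x, forall v,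
    `|'D_v ('D_v H) y - 'D_v ('D_v H) x| <= eps * `|v| ^+ 2.
Proof.
move=> sH eps0; have [_ DH] := sH.
have e40 : 0 < eps / 4 by rewrite divr_gt0.
have n u := derive_near_unif x (DH u) e40.
have N := filterI (filterI (n e11) (n e12)) (filterI (n e21) (n e22)).
apply: (filterS _ (N _ _ _)) => y [[h1 h2] [h3 h4]] v.
apply: (normB_eq_le (derive2_coord y v v sH) (derive2_coord x v v sH)).
have -> : eps * `|v| ^+ 2 = 4 * (`|v| * (eps / 4 * `|v|)) by field.
exact: (norm_sum4B (cplx2_norm_coord v) (And4 (h1 v) (h2 v) (h3 v) (h4 v))).
Qed.

Lemma derive2_bounded (H : cplx2 R -> R) (x : cplx2 R) : smooth_Ck 2 H ->
  exists2 M, 0 <= M & forall v, `|'D_v ('D_v H) x| <= M * `|v| ^+ 2.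
Proof.
move=> sH; have [_ DH] := sH.
have n u := derive_bounded ((DH u).1 x).
have [[M1 ? h1] [M2 ? h2]] := (n e11, n e12); have [[M3 ? h3] [M4 ? h4]] := (n e21, n e22).
exists (4 * (M1 + M2 + M3 + M4)); first by rewrite mulr_ge0// !addr_ge0.
move=> v; rewrite derive2_coord//.
have -> : 4 * (M1 + M2 + M3 + M4) * `|v| ^+ 2 = 4 * (`|v| * ((M1 + M2 + M3 + M4) * `|v|)) by ring.
apply: norm_sum4; first exact: cplx2_norm_coord.
by split; [apply: le_trans (h1 v) _|apply: le_trans (h2 v) _
  |apply: le_trans (h3 v) _|apply: le_trans (h4 v) _];
  rewrite ler_wpM2r//; lra.
Qed.

(** Schwarz's theorem. The second difference over the parallelogram spanned by [s u] and [s v] is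
    symmetric in [u] and [v]; computed in either order it is [s^2] times a mixed derivative at a
    point tending to [x] with [s], and both mixed derivatives are continuous. *)
Lemma derive_comm {V} (g : V -> R) (x u v : V) : smooth_Ck 2 g ->
  'D_u ('D_v g) x = 'D_v ('D_u g) x.
Proof.
move=> [dg Dg].
have key (a b : V) (s : R) : 0 < s -> exists c1 c2, [/\ 0 < c1 < s, 0 < c2 < s &
    g (x + s *: a + s *: b) - g (x + s *: a) - g (x + s *: b) + g x
    = s * (s * 'D_b ('D_a g) (x + c1 *: a + c2 *: b))].
  move=> s0.
  (* The second difference is the increment of [h] along [s *: a]; a mean value step for [h], then
     one for ['D_a g] along [s *: b], produce the two factors [s]. *)
  pose h := fun y => g (y + s *: b) - g y.
  have dgs y : is_diff y (fun y => g (y + s *: b)) ('d g (y + s *: b)).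
    have d1 : is_diff y (fun y : V => y + s *: b) id.
      have -> : (fun y : V => y + s *: b) = id + cst (s *: b) by [].
      by apply: is_diff_eq; rewrite addr0.
    exact: (is_diff_comp d1 (differentiableP (dg _))).
  have dgd y : differentiable (fun y => g (y + s *: b)) y by case: (dgs y).
  have dh y : differentiable h y by exact: differentiableB (dgd y) (dg y).
  have Dh w y : 'D_w h y = 'D_w g (y + s *: b) - 'D_w g y.
    rewrite (deriveE w (dh y)) (diffB (dgd y) (dg y)) /= (deriveE w (dg y)) (deriveE w (dg _)).
    by have [_ ->] := dgs y.
  have [c /andP[c0 c1] Ec] := mean_value_line x (s *: a) dh.
  have [d /andP[d0 d1] Ed] := mean_value_line (x + (c * s) *: a) (s *: b) (Dg a).1.
  exists (c * s), (d * s); split.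
  - by rewrite mulr_gt0//= gtr_pMl.
  - by rewrite mulr_gt0//= gtr_pMl.
  have DZ (f : V -> R) z w : differentiable f z -> 'D_(s *: w) f z = s * 'D_w f z.
    by move=> df; rewrite !deriveE// linearZ.
  have ringE (p q r t : R) : p - q - r + t = p - q - (r - t) by ring.
  apply: (etrans (ringE _ _ _ _)); apply: (etrans Ec).
  apply: (etrans (DZ h _ a (dh _))); rewrite (Dh a); congr (_ * _).
  move: Ed; rewrite (DZ ('D_a g)); last exact: (Dg a).1.
  by rewrite !scalerA => ->.
apply/eqP; rewrite -subr_eq0 -normr_le0; apply/ler_addgt0Pr => e e0; rewrite add0r.
have e20 : 0 < e / 2 by rewrite divr_gt0.
have near_line (f : V -> R) (a b : V) : continuous f -> \forall s \near 0^'+, forall c1 c2 : R,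
    0 < c1 < s -> 0 < c2 < s -> `|f (x + c1 *: a + c2 *: b) - f x| <= e / 2.
  move=> cf; have := cf x => /cvgrPdist_le /(_ _ e20) /nbhs_ballP[r /= r0 rB].
  pose N := 1 + `|a| + `|b|.
  have N0 : 0 < N by rewrite /N; have := normr_ge0 a; have := normr_ge0 b; lra.
  near=> s => c1 c2 /andP[c10 c1s] /andP[c20 c2s].
  rewrite distrC; apply: rB; rewrite -ball_normE /= opprD addrA opprD addrA subrr add0r.
  rewrite -opprD normrN (le_lt_trans (ler_normD _ _))// !normrZ !gtr0_norm//.
  have sr : s * N < r by rewrite -ltr_pdivlMr//; near: s; apply: nbhs_right_lt; rewrite divr_gt0.
  have A0 := normr_ge0 a; have B0 := normr_ge0 b.
  have : c1 * `|a| <= s * `|a| by rewrite ler_wpM2r// ltW.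
  have : c2 * `|b| <= s * `|b| by rewrite ler_wpM2r// ltW.
  have : 0 < s by apply: lt_trans c1s.
  by move: sr; rewrite /N; lra.
have n1 := near_line _ u v ((Dg u).2 v).
have n2 := near_line _ v u ((Dg v).2 u).
have [s [[s1 s2] s0]] := filter_ex (filterI (filterI n1 n2) (nbhs_right_gt (0 : R))).
have [c1 [c2 [h1 h2 E1]]] := key u v s s0.
have [d1 [d2 [k1 k2 E2]]] := key v u s s0.
(* The two computations of the same second difference agree, and [s] is cancelled twice. *)
have E : 'D_v ('D_u g) (x + c1 *: u + c2 *: v) = 'D_u ('D_v g) (x + d1 *: v + d2 *: u).
  have sI : injective ( *%R s) by apply: mulfI; rewrite gt_eqF.
  apply: (sI); apply: (sI); apply: (etrans (esym E1)); apply: (etrans _ E2).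
  have swap (p q r t : R) : p - q - r + t = p - r - q + t by ring.
  by rewrite (addrAC x (s *: v)); exact: swap.
have A := s1 _ _ h1 h2; have B := s2 _ _ k1 k2; rewrite E in A.
apply: (le_trans (ler_distD ('D_u ('D_v g) (x + d1 *: v + d2 *: u)) _ _)).
have ee : e / 2 + e / 2 <= e by rewrite -splitr.
have swap (p q : R) : `|p - q| <= e / 2 -> `|q - p| <= e / 2 by rewrite distrC.
exact: (le_trans (lerD (swap _ _ B) A) ee).
Unshelve. all: by end_near. Qed.

End Smooth3.

(** * Logarithmic coordinates and their derivatives *)

Section Log.
Context {R : realType}.
Implicit Types V W Z : normedModType R.

Definition polar (a : R) (u : cplx R) : cplx R :=
  (expR (- u.1) * cos (a + u.2), expR (- u.1) * sin (a + u.2)).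

Definition polar2 (a1 a2 : R) (w : cplx2 R) : cplx2 R := (polar a1 w.1, polar a2 w.2).

Lemma smoothN {V} k (u : V -> R) : smooth_Ck k u -> smooth_Ck k (fun x => - u x).
Proof.
move=> su; have -> : (fun x => - u x) = fun x => (-1) * u x by apply/funext => x; rewrite mulN1r.
by apply: smoothM => //; exact: smooth_cst.
Qed.

Lemma smooth_polar {V} k (a : R) (u : V -> cplx R) :
  smooth_Ck k u -> smooth_Ck k (fun x => polar a (u x)).
Proof.
move=> su.
have se := smooth_expR (smoothN (smooth_fst su)).
have st := smoothD (smooth_cst k a) (smooth_snd su).
exact: (smooth_pair (smoothM se (smooth_cos st)) (smoothM se (smooth_sin st))).
Qed.

Lemma smooth_polar2 k a1 a2 : smooth_Ck k (polar2 a1 a2).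
Proof.
have si := smooth_id (V := cplx2 R) k.
exact: (smooth_pair (smooth_polar a1 (smooth_fst si)) (smooth_polar a2 (smooth_snd si))).
Qed.

Lemma derive_pair {V W Z} (f : V -> W) (g : V -> Z) (x v : V) :
  differentiable f x -> differentiable g x ->
  'D_v (fun x => (f x, g x)) x = ('D_v f x, 'D_v g x).
Proof.
move=> df dg; have dfg : differentiable (fun x => (f x, g x)) x by exact: differentiable_pair.
by rewrite deriveE// diff_pair// !deriveE.
Qed.

Lemma derive_fst {V W Z} (f : V -> W * Z) (x v : V) : differentiable f x ->
  'D_v (fun x => (f x).1) x = ('D_v f x).1.
Proof.
move=> df; have cf : continuous (@fst W Z) by move=> y; exact: cvg_fst.
have dl := linear_differentiable (f := (@fst W Z)) (f x) cf.
have dc : differentiable (fst \o f) x by exact: differentiable_comp.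
by rewrite [LHS](deriveE v dc) diff_comp//= diff_lin// deriveE.
Qed.

Lemma derive_snd {V W Z} (f : V -> W * Z) (x v : V) : differentiable f x ->
  'D_v (fun x => (f x).2) x = ('D_v f x).2.
Proof.
move=> df; have cf : continuous (@snd W Z) by move=> y; exact: cvg_snd.
have dl := linear_differentiable (f := (@snd W Z)) (f x) cf.
have dc : differentiable (snd \o f) x by exact: differentiable_comp.
by rewrite [LHS](deriveE v dc) diff_comp//= diff_lin// deriveE.
Qed.

(** [polar a u] is the complex exponential of [- u.1 + i (a + u.2)], so its derivative is itself
    times the derivative of the exponent. *)
Lemma derive_polar {V} (a : R) (u : V -> cplx R) (x v : V) : (forall y, differentiable u y) ->
  'D_v (fun y => polar a (u y)) x = cmul (- ('D_v u x).1, ('D_v u x).2) (polar a (u x)).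
Proof.
move=> du.
have d1 y : differentiable (fun y => (u y).1) y.
  apply: (@differentiable_comp _ _ _ _ u fst) => //.
  by apply: linear_differentiable => z; exact: cvg_fst.
have d2 y : differentiable (fun y => (u y).2) y.
  apply: (@differentiable_comp _ _ _ _ u snd) => //.
  by apply: linear_differentiable => z; exact: cvg_snd.
have dN : differentiable (fun y => - (u y).1) x by exact: differentiableN.
have DN : 'D_v (fun y => - (u y).1) x = - ('D_v u x).1.
  by rewrite deriveN ?derive_fst//; exact: diff_derivable.
have dS : differentiable (fun y => a + (u y).2) x.
  by apply: (@differentiableD _ _ _ (cst a)).
have DS : 'D_v (fun y => a + (u y).2) x = ('D_v u x).2.
  rewrite (@deriveD _ _ _ (cst a))//; [|exact: diff_derivable..].
  by rewrite derive_cst add0r derive_snd.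
have [de De] := chain_real v dN (is_derive_expR _).
have [dc Dc] := chain_real v dS (is_derive_cos _).
have [ds Ds] := chain_real v dS (is_derive_sin _).
rewrite /polar derive_pair; [|exact: differentiableM..].
rewrite deriveM; [|exact: diff_derivable..]; rewrite deriveM; [|exact: diff_derivable..].
rewrite De Dc Ds DN DS /cmul /= /GRing.scale /=.
by congr pair; ring.
Qed.

Lemma derive_polar2 a1 a2 (w v : cplx2 R) :
  'D_v (polar2 a1 a2) w = (cmul (- v.1.1, v.1.2) (polar a1 w.1), cmul (- v.2.1, v.2.2) (polar a2 w.2)).
Proof.
have d1 (y : cplx2 R) : differentiable (fst : cplx2 R -> cplx R) y.
  by apply: linear_differentiable => z; exact: cvg_fst.
have d2 (y : cplx2 R) : differentiable (snd : cplx2 R -> cplx R) y.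
  by apply: linear_differentiable => z; exact: cvg_snd.
have [s1 _] := smooth_polar (k := 1) a1 (smooth_fst (smooth_id (V := cplx2 R) 1)).
have [s2 _] := smooth_polar (k := 1) a2 (smooth_snd (smooth_id (V := cplx2 R) 1)).
rewrite (derive_pair v (s1 w) (s2 w)) (derive_polar a1 w v d1) (derive_polar a2 w v d2).
have -> : 'D_v (fst : cplx2 R -> cplx R) w = v.1.
  by rewrite deriveE// diff_lin// => z; exact: cvg_fst.
have -> : 'D_v (snd : cplx2 R -> cplx R) w = v.2.
  by rewrite deriveE// diff_lin// => z; exact: cvg_snd.
by [].
Qed.

End Log.

(** * Second-order expansions *)

Section Second.
Context {R : realType}.
Implicit Types V W Z : normedModType R.

Lemma smooth_lincomb2 {V} k (a b : R) (f g : V -> R) :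
  smooth_Ck k f -> smooth_Ck k g -> smooth_Ck k (fun x => a * f x + b * g x).
Proof.
by move=> sf sg; exact: (smoothD (smoothM (smooth_cst k a) sf) (smoothM (smooth_cst k b) sg)).
Qed.

Lemma derive_lincomb2 {V} (a b : R) (f g : V -> R) (x v : V) :
  differentiable f x -> differentiable g x ->
  'D_v (fun y => a * f y + b * g y) x = a * 'D_v f x + b * 'D_v g x.
Proof.
move=> df0 dg0.
have df : derivable f x v by exact: diff_derivable.
have dg : derivable g x v by exact: diff_derivable.
have k1 : derivable (a *: f) x v by exact: derivableZ.
have k2 : derivable (b *: g) x v by exact: derivableZ.
apply: (etrans (deriveD k1 k2)).
by rewrite (deriveZ a df) (deriveZ b dg).
Qed.

Lemma derive2_lincomb2 {V} (a b : R) (f g : V -> R) (x v u : V) :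
  smooth_Ck 2 f -> smooth_Ck 2 g ->
  'D_u ('D_v (fun y => a * f y + b * g y)) x = a * 'D_u ('D_v f) x + b * 'D_u ('D_v g) x.
Proof.
move=> [df Df] [dg Dg].
have E : 'D_v (fun y => a * f y + b * g y) = fun y => a * 'D_v f y + b * 'D_v g y.
  by apply/funext => y; exact: derive_lincomb2.
apply: (etrans (congr1 (fun h : V -> R => 'D_u h x) E)).
exact: (@derive_lincomb2 _ a b ('D_v f) ('D_v g) x u ((Df v).1 x) ((Dg v).1 x)).
Qed.

Lemma deriveZv {V} (f : V -> R) (x v : V) (s : R) : differentiable f x ->
  'D_(s *: v) f x = s * 'D_v f x.
Proof. by move=> df; rewrite !deriveE// linearZ. Qed.

Lemma near0_line {V} (f : V -> R) (x v : V) (e : R) : continuous f -> 0 < e ->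
  exists2 r, 0 < r & forall s, `|s| < r -> `|f (x + s *: v) - f x| <= e.
Proof.
move=> cf e0; have := cf x => /cvgrPdist_le /(_ _ e0) /nbhs_ballP[r /= r0 rB].
have N0 : 0 < 1 + `|v| by rewrite ltr_pwDl.
exists (r / (1 + `|v|)) => [|s sr]; first by rewrite divr_gt0.
rewrite distrC; apply: rB; rewrite -ball_normE /= opprD addrA subrr add0r normrN normrZ.
move: sr; rewrite ltr_pdivlMr// => sr; apply: le_lt_trans sr.
by rewrite ler_wpM2l// lerDr.
Qed.

(* The remainder k(s) = g(x+sv) - g x - s D - s^2/2 B has |k'(s)| <= e s by the
   mean value theorem applied to D_v g; a second mean value step gives |k| <= e t^2. *)
Lemma taylor2_line {V} (g : V -> R) (x v : V) (e : R) : smooth_Ck 2 g -> 0 < e ->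
  exists2 r, 0 < r & forall t, 0 < t < r ->
  `|g (x + t *: v) - g x - t * 'D_v g x - t ^+ 2 / 2 * 'D_v ('D_v g) x| <= e * t ^+ 2.
Proof.
move=> [dg Dg] e0.
have [r r0 rP] := near0_line x v ((Dg v).2 v) e0.
exists r => // t /andP[t0 tr].
set D := 'D_v g x; set B := 'D_v ('D_v g) x.
pose k (s : R) := g (x + s *: v) - s * D - s ^+ 2 / 2 * B.
have dk (s : R) : is_derive s 1 k ('D_v g (x + s *: v) - D - s * B).
  have h1 := is_derive_line (dg (x + s *: v)).
  have h2 : is_derive s 1 (fun s : R => s * D + s ^+ 2 / 2 * B) (D + s * B).
    have -> : (fun s : R => s * D + s ^+ 2 / 2 * B) = D *: id + (B / 2) *: (id ^+ 2).
      by apply/funext => y; rewrite !fctE /GRing.scale /=; field.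
    apply: is_derive_eq.
    by rewrite /GRing.scale /= expr1; field.
  have := is_deriveB h1 h2; congr is_derive.
    by apply/funext => y; rewrite /k /= opprD addrA.
  by rewrite opprD addrA.
have ck : {within `[0, t], continuous k}.
  by apply: derivable_within_continuous => s _; have [] := dk s.
have [c] := MVT t0 (fun s _ => dk s) ck.
rewrite in_itv/= subr0 => /andP[c0 ct] Ek.
have [d /andP[d0 d1] Ed] := mean_value_line x (c *: v) (Dg v).1.
have Ed' := etrans Ed (deriveZv v c ((Dg v).1 (x + d *: (c *: v)))).
have Bd : `|'D_v ('D_v g) (x + d *: (c *: v)) - B| <= e.
  rewrite scalerA; apply: rP; rewrite gtr0_norm ?mulr_gt0//.
  by rewrite (lt_trans _ (lt_trans ct tr))// gtr_pMl.
move: Ek Ed' Bd; rewrite /k scale0r addr0 expr0n /= !mul0r !subr0.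
move: (g (x + t *: v)) (g x) ('D_v g (x + c *: v)) ('D_v ('D_v g) (x + d *: (c *: v))).
move=> p q a b Ek Ea /ler_normlP[b1 b2].
have -> : p - q - t * D - t ^+ 2 / 2 * B = c * t * (b - B).
  have -> : p - q - t * D - t ^+ 2 / 2 * B = (a - D - c * B) * t by rewrite -Ek; ring.
  by rewrite [a - D]Ea; ring.
rewrite normrM gtr0_norm ?mulr_gt0// expr2 mulrC ler_pM ?mulr_ge0//; try exact: ltW.
  by apply/ler_normlP; split.
by rewrite ler_pM2r// ltW.
Qed.

(** Subtracting the Taylor expansion leaves [t D + t^2 (B / 2 + q) = o(t^2)] for [t > 0], where [D]
    and [B] are the first and second derivatives along [v]. Dividing by [t] gives [D = 0], and then
    dividing by [t^2] gives [B = - 2 q]. *)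
Lemma taylor2_unique {V} (g : V -> R) (v : V) (q : R) : smooth_Ck 2 g ->
  (forall e, 0 < e -> exists2 r, 0 < r & forall t, 0 < t < r ->
    `|g (t *: v) - (g 0 - t ^+ 2 * q)| <= e * t ^+ 2) ->
  'D_v ('D_v g) 0 = - 2 * q.
Proof.
move=> sg hq.
have T e (e0 : 0 < e) : exists2 r, 0 < r & forall t, 0 < t < r ->
    `|t * 'D_v g 0 + t ^+ 2 * ('D_v ('D_v g) 0 / 2 + q)| <= e * t ^+ 2.
  have e20 : 0 < e / 2 by rewrite divr_gt0.
  have [r1 r10 h1] := hq _ e20; have [r2 r20 h2] := taylor2_line 0 v sg e20.
  exists (Num.min r1 r2) => [|t]; first by rewrite lt_min r10.
  rewrite lt_min => /and3P[t0 t1 t2].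
  have := h1 t; rewrite t0 t1 => /(_ isT); have := h2 t; rewrite t0 t2 => /(_ isT).
  rewrite add0r; move: (g (t *: v)) (g 0) ('D_v g 0) ('D_v ('D_v g) 0) => a b c d.
  move=> /ler_normlP[x1 x2] /ler_normlP[y1 y2]; apply/ler_normlP; split; lra.
move: T; move: ('D_v g 0) ('D_v ('D_v g) 0) => D B T.
(* The 2 in the denominator makes [t < e] strict even when [m = 0]. *)
have small (m e : R) : 0 < e -> 0 <= m -> exists2 t, 0 < t < e & t * m <= e.
  move=> e0 m0; exists (e / (m + 2)).
    by rewrite divr_gt0 ?ltr_wpDl//= ltr_pdivrMr ?ltr_wpDl// ltr_pMr//; lra.
  by rewrite mulrAC ler_pdivrMr ?ltr_wpDl// ler_pM2l//; lra.
(* Tolerance 1 suffices here: [|D| <= t (1 + |B / 2 + q|)] for arbitrarily small [t]. *)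
have D0 : D = 0.
  apply/eqP; rewrite -normr_le0; apply/ler_addgt0Pr => e e0; rewrite add0r.
  have [r r0 hr] := T 1 ltr01.
  have m0 : 0 <= 1 + `|B / 2 + q| by rewrite addr_ge0.
  have er0 : 0 < Num.min e r by rewrite lt_min e0.
  have [t /andP[t0 tr] tm] := small _ _ er0 m0.
  move: tr tm; rewrite lt_min le_min => /andP[te tr] /andP[tm _].
  have := hr t; rewrite t0 tr => /(_ isT) h.
  apply: (le_trans _ tm); rewrite -(ler_pM2l t0).
  have : `|t * D| <= 1 * t ^+ 2 + `|t ^+ 2 * (B / 2 + q)|.
    rewrite -[t * D](addrK (t ^+ 2 * (B / 2 + q))) (le_trans (ler_normB _ _))//.
    by rewrite lerD2r.
  rewrite !normrM !(gtr0_norm t0).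
  by rewrite expr2; move: (`|D|) (`|B / 2 + q|) => *; lra.
have : B / 2 + q = 0.
  apply/eqP; rewrite -normr_le0; apply/ler_addgt0Pr => e e0; rewrite add0r.
  have [r r0 hr] := T e e0.
  have := hr (r / 2); rewrite divr_gt0//= ltr_pdivrMr// ltr_pMr// ltr1n => /(_ isT).
  rewrite D0 mulr0 add0r normrM (ger0_norm (sqr_ge0 _)) mulrC ler_pM2r// exprn_gt0// divr_gt0//.
by move: B {T} D0 => B _; lra.
Qed.

(** The function [f s = g (m + s v) + g (m - s v) + s^2 k] does not increase overall from 0 to 1:
    its derivative at [c] is [2 c] times the second derivative of [g] along [v], at a point between
    [m - c v] and [m + c v], plus [2 c k]. *)
Lemma concave_midpoint {V} (g : V -> R) (m v : V) (k : R) : smooth_Ck 2 g ->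
  (forall t : R, `|t| <= 1 -> 'D_v ('D_v g) (m + t *: v) <= - k) ->
  g (m + v) + g (m - v) <= 2 * g m - k.
Proof.
move=> [dg Dg] hk.
pose f (s : R) := g (m + s *: v) + g (m + s *: (- v)) + s ^+ 2 * k.
have DN y : 'D_(- v) g y = - 'D_v g y by rewrite !deriveE// linearN.
have df (s : R) : is_derive s 1 f ('D_v g (m + s *: v) - 'D_v g (m + s *: - v) + 2 * s * k).
  have h1 := is_derive_line (dg (m + s *: v)).
  have h2 := is_derive_line (dg (m + s *: - v)).
  have h3 : is_derive s 1 (fun s : R => s ^+ 2 * k) (2 * s * k).
    have -> : (fun s : R => s ^+ 2 * k) = k *: (id ^+ 2).
      by apply/funext => y; rewrite !fctE /GRing.scale /= mulrC.
    by apply: is_derive_eq; rewrite /GRing.scale /= expr1; ring.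
  have := is_deriveD (is_deriveD h1 h2) h3; congr is_derive.
  by rewrite (DN (m + s *: - v)).
have cf : {within `[0, 1], continuous f}.
  by apply: derivable_within_continuous => s _; have [] := df s.
have [c] := MVT ltr01 (fun s _ => df s) cf.
rewrite in_itv/= subr0 mulr1 => /andP[c0 c1] Ef.
have [d /andP[d0 d1] Ed] := mean_value_line (m + c *: - v) ((2 * c) *: v) (Dg v).1.
have Ed' := etrans Ed (deriveZv v (2 * c) ((Dg v).1 _)).
have e1 : m + c *: - v + (2 * c) *: v = m + c *: v.
  by rewrite -addrA; congr (_ + _); rewrite scalerN -scaleNr -scalerDl; congr (_ *: _); ring.
have e2 : m + c *: - v + d *: ((2 * c) *: v) = m + (c * (2 * d - 1)) *: v.
  by rewrite -addrA scalerA; congr (_ + _); rewrite scalerN -scaleNr -scalerDl; congr (_ *: _); ring.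
rewrite e1 e2 in Ed'.
have B : 'D_v ('D_v g) (m + (c * (2 * d - 1)) *: v) <= - k.
  apply: hk; rewrite normrM (gtr0_norm c0).
  have : `|2 * d - 1| <= 1 by apply/ler_normlP; split; lra.
  by move=> h; rewrite mulr_ile1// ltW.
move: Ef Ed' B; rewrite /f !scale1r !scale0r !addr0 expr1n expr0n /= mul0r addr0 mul1r.
move: (g (m + v)) (g (m - v)) (g m) ('D_v g _) ('D_v g _) ('D_v ('D_v g) _) => a b p x y z.
move=> E1 E2 hz; have : 2 * c * (z + k) <= 0.
  by apply: mulr_ge0_le0; [rewrite mulr_ge0 ?ltW|lra].
move=> hh; have : a + b + k - (p + p) <= 0 by rewrite E1 E2; move: hh; rewrite mulrDr; lra.
lra.
Qed.

End Second.

(** * Boundary behaviour *)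

Section Boundary.
Context {R : realType}.
Implicit Types V W Z : normedModType R.

(** Moving from [w] along [e11 + e21] enters the open quadrant at once. This carries to [rho_j = 0]
    the relations known only inside the bidisc. *)
Lemma le0_quadrant_closure (f : cplx2 R -> R) : continuous f ->
  (forall w, 0 < w.1.1 -> 0 < w.2.1 -> f w <= 0) ->
  forall w, 0 <= w.1.1 -> 0 <= w.2.1 -> f w <= 0.
Proof.
move=> cf hf w w1 w2; apply/ler_addgt0Pr => e e0; rewrite add0r.
have [r r0 hr] := near0_line w (e11 + e21) cf e0.
have r20 : 0 < r / 2 by rewrite divr_gt0.
have := hr (r / 2); rewrite gtr0_norm// ltr_pdivrMr// ltr_pMr// ltr1n => /(_ isT).
have fw : f (w + (r / 2) *: (e11 + e21)) <= 0.
  by apply: hf; rewrite /= ?add0r ?addr0 /GRing.scale /= mulr1 ltr_wpDl.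
by move=> /ler_normlP[h1 h2]; lra.
Qed.

Lemma eq_quadrant_closure (f g : cplx2 R -> R) : continuous f -> continuous g ->
  (forall w, 0 < w.1.1 -> 0 < w.2.1 -> f w = g w) -> f 0 = g 0.
Proof.
move=> cf cg fg; apply/eqP; rewrite eq_le -subr_le0 -[g 0 <= _]subr_le0; apply/andP; split.
  apply: (@le0_quadrant_closure (fun w => f w - g w)) => // [w|w h1 h2].
    by apply: cvgB; [exact: cf|exact: cg].
  by rewrite fg// subrr.
apply: (@le0_quadrant_closure (fun w => g w - f w)) => // [w|w h1 h2].
  by apply: cvgB; [exact: cg|exact: cf].
by rewrite fg// subrr.
Qed.

Lemma quadrant_open : open [set w : cplx2 R | 0 < w.1.1 /\ 0 < w.2.1].
Proof.
have c1 : continuous (fun w : cplx2 R => w.1.1).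
  by apply: smooth_continuous; exact: (smooth_fst (smooth_fst (smooth_id 0))).
have c2 : continuous (fun w : cplx2 R => w.2.1).
  by apply: smooth_continuous; exact: (smooth_fst (smooth_snd (smooth_id 0))).
apply: openI.
  by apply: (open_comp _ (@open_gt R 0)) => x _; exact: c1.
by apply: (open_comp _ (@open_gt R 0)) => x _; exact: c2.
Qed.

Lemma derive_near_eq {V W} (f g : V -> W) (x v : V) (O : set V) : open O -> O x ->
  (forall y, O y -> f y = g y) -> 'D_v f x = 'D_v g x.
Proof.
move=> oO Ox fg; have [->|v0] := eqVneq v 0; first by rewrite !derive0.
apply: near_eq_derive => //.
have : nbhs x O by exact: open_nbhs_nbhs.
by apply: filterS => y /fg ->.
Qed.

(** In the open quadrant [D_v D_v P1 = D_v D_u P2 = D_u D_v P2 = - D_u D_u P1], and similarly for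
    [P2]. The equations may be differentiated because they hold on an open set; the result passes to
    the origin by continuity. *)
Lemma harmonic_at0 (P1 P2 : cplx2 R -> R) (u v : cplx2 R) :
  smooth_Ck 2 P1 -> smooth_Ck 2 P2 ->
  (forall w, 0 < w.1.1 -> 0 < w.2.1 -> 'D_v P1 w = 'D_u P2 w /\ 'D_v P2 w = - 'D_u P1 w) ->
  'D_v ('D_v P1) 0 = - 'D_u ('D_u P1) 0 /\ 'D_v ('D_v P2) 0 = - 'D_u ('D_u P2) 0.
Proof.
move=> s1 s2 CR; have [[d1 D1] [d2 D2]] := (s1, s2).
pose O := [set w : cplx2 R | 0 < w.1.1 /\ 0 < w.2.1].
have neg (P : cplx2 R -> R) w : smooth_Ck 2 P -> 'D_u (fun y => - 'D_u P y) w = - 'D_u ('D_u P) w.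
  by move=> [_ D]; apply: deriveN; apply: diff_derivable; exact: (D u).1.
have negv (P : cplx2 R -> R) w : smooth_Ck 2 P -> 'D_v (fun y => - 'D_u P y) w = - 'D_v ('D_u P) w.
  by move=> [_ D]; apply: deriveN; apply: diff_derivable; exact: (D u).1.
split.
  apply: (@eq_quadrant_closure ('D_v ('D_v P1)) (fun w => - 'D_u ('D_u P1) w)).
  - exact: ((D1 v).2 v).
  - by move=> w; apply: cvgN; exact: ((D1 u).2 u).
  move=> w w1 w2.
  have E1 := @derive_near_eq _ _ ('D_v P1) ('D_u P2) w v O quadrant_open (conj w1 w2)
     (fun y h => (CR y h.1 h.2).1).
  have E2 := @derive_near_eq _ _ ('D_v P2) (fun y => - 'D_u P1 y) w u O quadrant_open (conj w1 w2)
     (fun y h => (CR y h.1 h.2).2).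
  exact: (etrans E1 (etrans (derive_comm w v u s2) (etrans E2 (neg P1 w s1)))).
apply: (@eq_quadrant_closure ('D_v ('D_v P2)) (fun w => - 'D_u ('D_u P2) w)).
- exact: ((D2 v).2 v).
- by move=> w; apply: cvgN; exact: ((D2 u).2 u).
move=> w w1 w2.
have E1 := @derive_near_eq _ _ ('D_v P2) (fun y => - 'D_u P1 y) w v O quadrant_open (conj w1 w2)
   (fun y h => (CR y h.1 h.2).2).
have E2 := @derive_near_eq _ _ ('D_v P1) ('D_u P2) w u O quadrant_open (conj w1 w2)
   (fun y h => (CR y h.1 h.2).1).
exact: (etrans E1 (etrans (negv P1 w s1) (congr1 -%R (etrans (derive_comm w v u s1) E2)))).
Qed.

(* Replaces the Hopf lemma: only second-order information at the maximum is used. *)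
Lemma derive_lt0_of_max {V} (g : V -> R) (v : V) : smooth_Ck 2 g ->
  (forall t, 0 < t -> g (t *: v) <= g 0) -> 0 < 'D_v ('D_v g) 0 -> 'D_v g 0 < 0.
Proof.
move=> sg gmax B0.
(* With [B] the second derivative, an error [B / 4 * t^2] still leaves [B / 4 * t^2] of the
   quadratic term, so that [D + t B / 4 <= 0] at one [t > 0]. *)
have e0 : 0 < 'D_v ('D_v g) 0 / 4 by rewrite divr_gt0.
have [r r0 h] := taylor2_line 0 v sg e0.
have t0 : 0 < r / 2 by rewrite divr_gt0.
have tr : r / 2 < r by rewrite ltr_pdivrMr// ltr_pMr// ltr1n.
have := h (r / 2); rewrite t0 tr => /(_ isT); rewrite add0r.
have := gmax _ t0; move: B0 t0 {h e0}.
move: (r / 2) (g _) (g 0) ('D_v g 0) ('D_v ('D_v g) 0) => t a b D B B0 t0 ab.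
move=> /ler_normlP[h1 h2].
have : t * (D + t * (B / 4)) <= 0 by lra.
rewrite pmulr_rle0// => h3.
have : 0 < t * (B / 4) by rewrite mulr_gt0// divr_gt0.
lra.
Qed.

(** The constant [k] is determinant over trace, that is [l1 l2 / (l1 + l2)] for the eigenvalues
    [l1], [l2], which is below both. Completing the square in [(a - k) (Q - k |t|^2)] leaves the
    coefficient [k^2] for [t.2^2]. *)
Lemma qform_gt0_coercive (a b c : R) : (forall t : R * R, t != 0 -> 0 < qform a b c t) ->
  exists2 k, 0 < k & forall t, k * (t.1 ^+ 2 + t.2 ^+ 2) <= qform a b c t.
Proof.
move=> Q.
have a0 : 0 < a.
  have := Q (1, 0); rewrite /qform /= => /(_ _).
  rewrite !(expr0n, expr1n, mulr1, mulr0, addr0)/=; apply.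
  by apply/eqP => -[] /eqP; rewrite oner_eq0.
have c0 : 0 < c.
  have := Q (0, 1); rewrite /qform /= => /(_ _).
  rewrite !(expr0n, expr1n, mulr1, mulr0, add0r)/=; apply.
  by apply/eqP => -[] /eqP; rewrite oner_eq0.
have det0 : 0 < a * c - b ^+ 2.
  rewrite -(pmulr_rgt0 _ a0).
  (* At this vector the form equals [a] times the determinant. *)
  have := Q (- b, a); rewrite /qform /= => /(_ _).
  have -> : a * (- b) ^+ 2 + 2 * b * - b * a + c * a ^+ 2 = a * (a * c - b ^+ 2) by ring.
  by apply; apply/eqP => -[] _ /eqP; rewrite gt_eqF.
pose k := (a * c - b ^+ 2) / (a + c).
have ac0 : 0 < a + c by rewrite addr_gt0.
have k0 : 0 < k by rewrite divr_gt0.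
have kE : k * (a + c) = a * c - b ^+ 2 by rewrite /k divfK// gt_eqF.
have ak : 0 < a - k.
  rewrite -(pmulr_lgt0 _ ac0) mulrBl kE.
  have -> : a * (a + c) - (a * c - b ^+ 2) = a * a + b ^+ 2 by ring.
  by rewrite ltr_pwDl ?mulr_gt0 ?sqr_ge0.
exists k => // t; rewrite -subr_ge0 -(pmulr_rge0 _ ak) /qform.
have -> : (a - k) * (a * t.1 ^+ 2 + 2 * b * t.1 * t.2 + c * t.2 ^+ 2 - k * (t.1 ^+ 2 + t.2 ^+ 2))
   = ((a - k) * t.1 + b * t.2) ^+ 2 + k ^+ 2 * t.2 ^+ 2 + (a * c - b ^+ 2 - k * (a + c)) * t.2 ^+ 2 by ring.
by rewrite kE subrr mul0r addr0 addr_ge0 ?sqr_ge0// mulr_ge0 ?sqr_ge0.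
Qed.

(** Split [n . p = c . q + n . (p - q) + (n - c) . q]: the point and the normal are perturbed at the
    same time. *)
Lemma norm_lincomb_near (n1 n2 c1 c2 p1 p2 q1 q2 k e M n : R) :
  `|n1| <= 1 -> `|n2| <= 1 -> `|n1 - c1| <= k -> `|n2 - c2| <= k ->
  `|p1 - q1| <= e * n -> `|p2 - q2| <= e * n -> `|q1| <= M * n -> `|q2| <= M * n ->
  n1 * p1 + n2 * p2 <= c1 * q1 + c2 * q2 + 2 * e * n + 2 * k * (M * n).
Proof.
move=> hn1 hn2 h1 h2 e1 e2 m1 m2.
have b (x y u w : R) : `|x| <= u -> `|y| <= w -> x * y <= u * w.
  by move=> ? ?; apply: (le_trans (ler_norm _)); rewrite normrM ler_pM.
have := b _ _ _ _ hn1 e1; have := b _ _ _ _ hn2 e2.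
have := b _ _ _ _ h1 m1; have := b _ _ _ _ h2 m2.
lra.
Qed.

End Boundary.

(** * Local geometry in logarithmic coordinates *)

Section Geometry.
Context {R : realType}.
Implicit Types V W Z : normedModType R.

Definition torus_vec (t : R * R) : cplx2 R := ((0, t.1), (0, t.2)).
Definition radial_vec (t : R * R) : cplx2 R := ((t.1, 0), (t.2, 0)).

Lemma norm_pair_le {V W} (x : V) (y : W) (m : R) : `|x| <= m -> `|y| <= m -> `|(x, y)| <= m.
Proof. by move=> hx hy; rewrite prod_normE /= ge_max hx. Qed.

Lemma norm_radial_vec t : 0 <= t.1 -> 0 <= t.2 -> `|radial_vec t| <= t.1 + t.2.
Proof.
move=> t1 t2.
by do !apply: norm_pair_le; rewrite ?normr0 ?addr_ge0// ger0_norm// ?lerDl ?lerDr.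
Qed.

Lemma sqr_norm_torus_vec t : `|torus_vec t| ^+ 2 <= t.1 ^+ 2 + t.2 ^+ 2.
Proof.
suff : `|torus_vec t| <= Num.sqrt (t.1 ^+ 2 + t.2 ^+ 2).
  move=> h; rewrite -[leRHS]sqr_sqrtr ?addr_ge0 ?sqr_ge0//.
  by rewrite ler_pXn2r// nnegrE ?sqrtr_ge0.
by do !apply: norm_pair_le; rewrite ?normr0 ?sqrtr_ge0// -sqrtr_sqr ler_wsqrtr// ?lerDl ?lerDr sqr_ge0.
Qed.

(** Harmonicity, [x = - z] and [y = - u], turns the negative angular second derivative [- 2 q] of a
    combination into a positive radial one. *)
Lemma laplace_gt0 (a b x y z u q : R) : x = - z -> y = - u ->
  a * x + b * y = - 2 * q -> 0 < q -> 0 < a * z + b * u.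
Proof.
move=> -> -> h q0; have -> : a * z + b * u = - (a * - z + b * - u) by ring.
by rewrite h; lra.
Qed.

Context (P1 P2 : cplx2 R -> R) (qa qb qc : R).
Context (s1 : smooth_Ck 2 P1).
Context (s2 : smooth_Ck 2 P2).
Context (P_le1 : forall w : cplx2 R, 0 <= w.1.1 -> 0 <= w.2.1 -> P1 w ^+ 2 + P2 w ^+ 2 <= 1).
Context (P0_1 : P1 0 ^+ 2 + P2 0 ^+ 2 = 1).
Context (CR1 : forall w : cplx2 R, 0 < w.1.1 -> 0 < w.2.1 ->
  'D_e12 P1 w = 'D_e11 P2 w /\ 'D_e12 P2 w = - 'D_e11 P1 w).
Context (CR2 : forall w : cplx2 R, 0 < w.1.1 -> 0 < w.2.1 ->
  'D_e22 P1 w = 'D_e21 P2 w /\ 'D_e22 P2 w = - 'D_e21 P1 w).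
Context (Q_gt0 : forall t : R * R, t != 0 -> 0 < qform qa qb qc t).
Context (P_expand : forall e, 0 < e -> exists2 r, 0 < r & forall t : R * R, `|t| < r ->
  `|P1 0 * P1 (torus_vec t) + P2 0 * P2 (torus_vec t) - (1 - qform qa qb qc t)| <= e * `|t| ^+ 2).

(** With [eta = n1 + i n2] and [Phi = P1 + i P2] this is [g_eta = Re (conj eta Phi)]. The pair
    [(c1, c2)] introduced below is [Phi(0)], the value [phi(xi)]. *)
Let comb (n1 n2 : R) (w : cplx2 R) : R := n1 * P1 w + n2 * P2 w.

Let smooth_comb n1 n2 : smooth_Ck 2 (comb n1 n2).
Proof. exact: smooth_lincomb2. Qed.

Let d1 : forall x, differentiable P1 x := s1.1.
Let d2 : forall x, differentiable P2 x := s2.1.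

Let derive_combE n1 n2 v x : 'D_v (comb n1 n2) x = n1 * 'D_v P1 x + n2 * 'D_v P2 x.
Proof. exact: (@derive_lincomb2 _ _ n1 n2 P1 P2 x v (d1 x) (d2 x)). Qed.

Let derive2_combE n1 n2 v x :
  'D_v ('D_v (comb n1 n2)) x = n1 * 'D_v ('D_v P1) x + n2 * 'D_v ('D_v P2) x.
Proof. exact: (@derive2_lincomb2 _ _ n1 n2 P1 P2 x v v s1 s2). Qed.

Lemma comb_le1 n1 n2 w : n1 ^+ 2 + n2 ^+ 2 = 1 -> 0 <= w.1.1 -> 0 <= w.2.1 -> comb n1 n2 w <= 1.
Proof.
move=> hn w1 w2; have := P_le1 w1 w2; rewrite /comb.
by move: (P1 w) (P2 w) => p q; have := sqr_ge0 (n1 - p); have := sqr_ge0 (n2 - q); lra.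
Qed.

Let c1 := P1 0.
Let c2 := P2 0.

Let comb0 : comb c1 c2 0 = 1.
Proof. by rewrite /comb -!expr2. Qed.

(** Along the ray [s t] the assumption [P_expand] is an expansion in [s] up to [o(s^2)], whose
    quadratic coefficient is unique. *)
Lemma torus_derive2 t :
  'D_(torus_vec t) ('D_(torus_vec t) (comb c1 c2)) 0 = - 2 * qform qa qb qc t.
Proof.
apply: taylor2_unique; first exact: smooth_comb.
move=> e e0.
(* The expansion measures its error by [|s t|^2], so the tolerance is divided by a bound for
   [|t|^2]; the 1 covers [t = 0]. *)
have m0 : 0 < e / (1 + `|t| ^+ 2) by rewrite divr_gt0// ltr_pwDl ?sqr_ge0.
have [r r0 hr] := P_expand m0.
exists (r / (1 + `|t|)) => [|s /andP[s0 sr]]; first by rewrite divr_gt0// ltr_pwDl.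
have st : `|s *: t| < r.
  rewrite normrZ gtr0_norm//; move: sr; rewrite ltr_pdivlMr ?ltr_pwDl//.
  by apply: le_lt_trans; rewrite ler_pM2l// lerDr.
have := hr _ st.
have -> : torus_vec (s *: t) = s *: torus_vec t.
  by apply: injective_projections; apply: injective_projections;
    rewrite /= /GRing.scale /= ?mulr0.
have -> : qform qa qb qc (s *: t) = s ^+ 2 * qform qa qb qc t.
  by rewrite /qform /= /GRing.scale /=; ring.
rewrite comb0 => h; apply: (le_trans h).
rewrite normrZ exprMn (gtr0_norm s0) mulrCA [leRHS]mulrC ler_pM2l ?exprn_gt0//.
by rewrite mulrAC ler_pdivrMr ?ltr_pwDl ?sqr_ge0// ler_pM2l// lerDr.
Qed.

Let comb_max (v : cplx2 R) : 0 <= v.1.1 -> 0 <= v.2.1 ->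
  forall t : R, 0 < t -> comb c1 c2 (t *: v) <= comb c1 c2 0.
Proof.
move=> v1 v2 t t0; rewrite comb0; apply: comb_le1 => //=.
  by rewrite /GRing.scale /= mulr_ge0// ltW.
by rewrite /GRing.scale /= mulr_ge0// ltW.
Qed.

Lemma normal_derive1_lt0 : 'D_e11 (comb c1 c2) 0 < 0.
Proof.
apply: derive_lt0_of_max; [exact: smooth_comb|exact: (@comb_max e11)|].
have [h1 h2] := @harmonic_at0 R P1 P2 e11 e12 s1 s2 CR1.
have h3 := etrans (esym (derive2_combE c1 c2 e12 0)) (torus_derive2 (1, 0)).
have q0 : 0 < qform qa qb qc (1, 0).
  by apply: Q_gt0; apply/eqP => -[] /eqP; rewrite oner_eq0.
exact: (eq_ind_r (fun z => 0 < z) (laplace_gt0 h1 h2 h3 q0) (derive2_combE c1 c2 e11 0)).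
Qed.

Lemma normal_derive2_lt0 : 'D_e21 (comb c1 c2) 0 < 0.
Proof.
apply: derive_lt0_of_max; [exact: smooth_comb|exact: (@comb_max e21)|].
have [h1 h2] := @harmonic_at0 R P1 P2 e21 e22 s1 s2 CR2.
have h3 := etrans (esym (derive2_combE c1 c2 e22 0)) (torus_derive2 (0, 1)).
have q0 : 0 < qform qa qb qc (0, 1).
  by apply: Q_gt0; apply/eqP => -[] /eqP; rewrite oner_eq0.
exact: (eq_ind_r (fun z => 0 < z) (laplace_gt0 h1 h2 h3 q0) (derive2_combE c1 c2 e21 0)).
Qed.


Lemma near0_ball (Pr : set (cplx2 R)) : (\forall y \near (0 : cplx2 R), Pr y) ->
  exists2 r, 0 < r & forall y, `|y| < r -> Pr y.
Proof.
move=> /nbhs_ballP[r /= r0 h]; exists r => // y yr; apply: h.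
by rewrite -ball_normE /= sub0r normrN.
Qed.

(** Each of the two perturbations, of the point and of the normal, costs at most [l / 4 * n], so
    half of the slope survives. It serves first derivatives with [n = t.1 + t.2] and second
    derivatives with [n = t.1^2 + t.2^2]. *)
Lemma slope_arith (n1 n2 a1 a2 p1 p2 q1 q2 M n l : R) : 0 < l -> 0 <= M -> 0 <= n ->
  `|n1| <= 1 -> `|n2| <= 1 -> `|n1 - a1| <= l / (8 * (M + 1)) -> `|n2 - a2| <= l / (8 * (M + 1)) ->
  `|p1 - q1| <= l / 8 * n -> `|p2 - q2| <= l / 8 * n -> `|q1| <= M * n -> `|q2| <= M * n ->
  a1 * q1 + a2 * q2 <= - l * n ->
  n1 * p1 + n2 * p2 <= - (l / 2) * n.
Proof.
move=> l0 M0 n0 h1 h2 h3 h4 h5 h6 h7 h8 h9.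
have := norm_lincomb_near h1 h2 h3 h4 h5 h6 h7 h8.
have : l / (8 * (M + 1)) * (M * n) <= l / 8 * n.
  rewrite mulrA ler_wpM2r// mulrAC ler_pdivrMr; last by rewrite mulr_gt0// ltr_wpDl.
  have -> : l / 8 * (8 * (M + 1)) = l * (M + 1) by field.
  by rewrite ler_pM2l// lerDl.
lra.
Qed.

Lemma eq_le_trans (x y z : R) : x = y -> y <= z -> x <= z.
Proof. by move=> ->. Qed.

Lemma slope_lincomb (a b x y z u l : R) : 0 <= a -> 0 <= b -> l <= - x -> l <= - y ->
  a * x + 0 * z + b * y + 0 * u <= - l * (a + b).
Proof. by move=> a0 b0 hx hy; have := ler_wpM2l a0 hx; have := ler_wpM2l b0 hy; lra. Qed.

Lemma coercive_slope (l n q : R) : 0 <= l * n -> l * n <= q -> - 2 * q <= - l * n.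
Proof. lra. Qed.

Lemma exists_slope (x y : R) : x < 0 -> y < 0 -> exists l, [/\ 0 < l, l <= - x & l <= - y].
Proof.
move=> x0 y0; exists (Num.min (- x) (- y)).
by rewrite lt_min !oppr_gt0 x0 y0 !ge_min !lexx orbT.
Qed.

(** At the origin and for [eta = phi(xi)] both radial derivatives are negative. By uniform
    continuity in the direction, half of this slope persists for nearby points and nearby [eta]. *)
Lemma radial_slope : exists l r k, [/\ 0 < l, 0 < r, 0 < k &
  forall n1 n2, `|n1| <= 1 -> `|n2| <= 1 -> `|n1 - c1| <= k -> `|n2 - c2| <= k ->
  forall p, `|p| < r -> forall t, 0 <= t.1 -> 0 <= t.2 ->
  'D_(radial_vec t) (comb n1 n2) p <= - l * (t.1 + t.2)].
Proof.
have [l [l0 lD1 lD2]] := exists_slope normal_derive1_lt0 normal_derive2_lt0.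
have [M1 M10 b1] := derive_bounded (d1 0); have [M2 M20 b2] := derive_bounded (d2 0).
have l80 : 0 < l / 8 by rewrite divr_gt0.
have [r1 r10 u1] := near0_ball (derive_near_unif 0 (smoothW s1) l80).
have [r2 r20 u2] := near0_ball (derive_near_unif 0 (smoothW s2) l80).
have M0 : 0 <= M1 + M2 by rewrite addr_ge0.
exists (l / 2), (Num.min r1 r2), (l / (8 * (M1 + M2 + 1))); split.
- by rewrite divr_gt0.
- by rewrite lt_min r10.
- by rewrite divr_gt0// mulr_gt0// ltr_wpDl.
move=> n1 n2 h1 h2 h3 h4 p; rewrite lt_min => /andP[p1 p2] t t1 t2.
have vn := norm_radial_vec t1 t2.
have n0 : 0 <= t.1 + t.2 by rewrite addr_ge0.
have le (m : R) : 0 <= m -> m * `|radial_vec t| <= m * (t.1 + t.2) by move=> m0; rewrite ler_wpM2l.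
have e1 := le_trans (u1 _ p1 (radial_vec t)) (le _ (ltW l80)).
have e2 := le_trans (u2 _ p2 (radial_vec t)) (le _ (ltW l80)).
have M1le : M1 <= M1 + M2 by rewrite lerDl.
have M2le : M2 <= M1 + M2 by rewrite lerDr.
have f1 := le_trans (b1 (radial_vec t)) (le_trans (le _ M10) (ler_wpM2r n0 M1le)).
have f2 := le_trans (b2 (radial_vec t)) (le_trans (le _ M20) (ler_wpM2r n0 M2le)).
have key : c1 * 'D_(radial_vec t) P1 0 + c2 * 'D_(radial_vec t) P2 0 <= - l * (t.1 + t.2).
  apply: (eq_le_trans (esym (derive_combE c1 c2 (radial_vec t) 0))).
  apply: (eq_le_trans (derive_coord (radial_vec t) ((smooth_comb c1 c2).1 0))).
  exact: (slope_lincomb _ _ t1 t2 lD1 lD2).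
exact: (eq_le_trans (derive_combE n1 n2 (radial_vec t) p)
  (slope_arith l0 M0 n0 h1 h2 h3 h4 e1 e2 f1 f2 key)).
Qed.

(** The same perturbation argument, started from the Hessian [- 2 Q] at the origin and the
    coercivity constant of [Q]. *)
Lemma torus_concavity : exists l r k, [/\ 0 < l, 0 < r, 0 < k &
  forall n1 n2, `|n1| <= 1 -> `|n2| <= 1 -> `|n1 - c1| <= k -> `|n2 - c2| <= k ->
  forall p, `|p| < r -> forall t,
  'D_(torus_vec t) ('D_(torus_vec t) (comb n1 n2)) p <= - l * (t.1 ^+ 2 + t.2 ^+ 2)].
Proof.
have [l l0 hl] := qform_gt0_coercive Q_gt0.
have [M1 M10 b1] := derive2_bounded 0 s1; have [M2 M20 b2] := derive2_bounded 0 s2.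
have l80 : 0 < l / 8 by rewrite divr_gt0.
have [r1 r10 u1] := near0_ball (derive2_near_unif 0 s1 l80).
have [r2 r20 u2] := near0_ball (derive2_near_unif 0 s2 l80).
have M0 : 0 <= M1 + M2 by rewrite addr_ge0.
exists (l / 2), (Num.min r1 r2), (l / (8 * (M1 + M2 + 1))); split.
- by rewrite divr_gt0.
- by rewrite lt_min r10.
- by rewrite divr_gt0// mulr_gt0// ltr_wpDl.
move=> n1 n2 h1 h2 h3 h4 p; rewrite lt_min => /andP[p1 p2] t.
have vn := sqr_norm_torus_vec t.
have n0 : 0 <= t.1 ^+ 2 + t.2 ^+ 2 by rewrite addr_ge0// sqr_ge0.
have le (m : R) : 0 <= m -> m * `|torus_vec t| ^+ 2 <= m * (t.1 ^+ 2 + t.2 ^+ 2).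
  by move=> m0; rewrite ler_wpM2l.
have e1 := le_trans (u1 _ p1 (torus_vec t)) (le _ (ltW l80)).
have e2 := le_trans (u2 _ p2 (torus_vec t)) (le _ (ltW l80)).
have M1le : M1 <= M1 + M2 by rewrite lerDl.
have M2le : M2 <= M1 + M2 by rewrite lerDr.
have f1 := le_trans (b1 (torus_vec t)) (le_trans (le _ M10) (ler_wpM2r n0 M1le)).
have f2 := le_trans (b2 (torus_vec t)) (le_trans (le _ M20) (ler_wpM2r n0 M2le)).
have key : c1 * 'D_(torus_vec t) ('D_(torus_vec t) P1) 0
         + c2 * 'D_(torus_vec t) ('D_(torus_vec t) P2) 0 <= - l * (t.1 ^+ 2 + t.2 ^+ 2).
  apply: (eq_le_trans (esym (derive2_combE c1 c2 (torus_vec t) 0))).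
  apply: (eq_le_trans (torus_derive2 t)).
  exact: (coercive_slope (mulr_ge0 (ltW l0) n0) (hl t)).
exact: (eq_le_trans (derive2_combE n1 n2 (torus_vec t) p)
  (slope_arith l0 M0 n0 h1 h2 h3 h4 e1 e2 f1 f2 key)).
Qed.

(** The matrix with rows [(A, B)] and [(B, - A)] multiplies lengths by [sqrt (A^2 + B^2) >= D]. If
    both [|p1|] and [|p2|] were below [D / 4 * m], both image coordinates would be at most
    [D / 2 * m], and the squared length of the image at most [D^2 m^2 / 2]. *)
Lemma bilipschitz_arith (A B D u1 u2 p1 p2 m : R) : 0 < D -> 0 <= m ->
  D ^+ 2 <= A ^+ 2 + B ^+ 2 -> m ^+ 2 <= u1 ^+ 2 + u2 ^+ 2 ->
  `|p1 - (u1 * A + u2 * B)| <= D / 4 * m -> `|p2 - (u1 * B + u2 * - A)| <= D / 4 * m ->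
  D / 4 * m <= `|p1| \/ D / 4 * m <= `|p2|.
Proof.
move=> D0 m0 hAB hu h1 h2.
have [|lt1] := leP (D / 4 * m) `|p1|; first by left.
have [|lt2] := leP (D / 4 * m) `|p2|; first by right.
have sq (p q : R) : `|p - q| <= D / 4 * m -> `|p| < D / 4 * m -> q ^+ 2 <= (D / 2 * m) ^+ 2 /\ 0 < m.
  move=> /ler_normlP[x1 x2] hp; have m1 : 0 < m.
    rewrite lt_neqAle m0 andbT; apply/eqP => m00; move: hp; rewrite -m00 mulr0.
    by rewrite ltNge normr_ge0.
  move: hp => /ltr_normlP[x3 x4]; split=> //.
  by rewrite -subr_ge0 subr_sqr mulr_ge0//; lra.
have [k1 m1] := sq _ _ h1 lt1; have [k2 _] := sq _ _ h2 lt2.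
have : m ^+ 2 * D ^+ 2 <= (u1 ^+ 2 + u2 ^+ 2) * (A ^+ 2 + B ^+ 2).
  by rewrite ler_pM ?sqr_ge0.
have : (u1 ^+ 2 + u2 ^+ 2) * (A ^+ 2 + B ^+ 2) =
  (u1 * A + u2 * B) ^+ 2 + (u1 * B + u2 * - A) ^+ 2 by ring.
have : 0 < m ^+ 2 * D ^+ 2 by rewrite mulr_gt0 ?exprn_gt0.
have : (D / 2 * m) ^+ 2 = m ^+ 2 * D ^+ 2 / 4 by field.
move: (m ^+ 2 * D ^+ 2) k1 k2 => X k1 k2 E1 X0 E2; rewrite E2.
by rewrite E1 in k1 k2; lra.
Qed.

Lemma norm_coord2 (u : R * R) : `|u| ^+ 2 <= u.1 ^+ 2 + u.2 ^+ 2.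
Proof.
by apply: (le_trans _ (sqr_norm_torus_vec u)); rewrite ler_pXn2r ?nnegrE//;
  case: u => x y; apply: norm_pair_le; have [] := cplx2_norm_coord (torus_vec (x, y)).
Qed.

Lemma norm_segment (w w' : cplx2 R) (r c : R) : 0 < c < 1 -> `|w| < r -> `|w'| < r ->
  `|w' + c *: (w - w')| < r.
Proof.
move=> /andP[h0 h1] wr wr'.
have -> : w' + c *: (w - w') = (1 - c) *: w' + c *: w.
  by rewrite scalerBr scalerBl scale1r addrAC addrA.
have c1' : 0 < 1 - c by rewrite subr_gt0.
rewrite (le_lt_trans (ler_normD _ _))// !normrZ !gtr0_norm//.
have -> : r = (1 - c) * r + c * r by ring.
by rewrite ltrD// ltr_pM2l.
Qed.

Lemma zero_lincomb (x y z u a b : R) : 0 * x + 0 * y + a * z + b * u = a * z + b * u.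
Proof. by rewrite !mul0r !add0r. Qed.

(** Near the origin the differential in the second variable is close to a similarity, by the
    Cauchy-Riemann equations. The conclusion is a disjunction because the mean value theorem is
    applied to [P1] and [P2] separately, at different intermediate points. *)
Lemma fiber_bilipschitz : exists r m, [/\ 0 < r, 0 < m &
  forall w w', `|w| < r -> `|w'| < r -> w.1 = w'.1 ->
    m * `|w.2 - w'.2| <= `|P1 w - P1 w'| \/ m * `|w.2 - w'.2| <= `|P2 w - P2 w'|].
Proof.
have [_ D1] := s1; have [_ D2] := s2.
have B1 : 'D_e22 P1 0 = 'D_e21 P2 0.
  apply: (@eq_quadrant_closure _ ('D_e22 P1) ('D_e21 P2)).
  - exact: (@smoothW R _ _ 0 _ (D1 e22)).
  - exact: (@smoothW R _ _ 0 _ (D2 e21)).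
  by move=> w w1 w2; exact: (CR2 w1 w2).1.
have B2 : 'D_e22 P2 0 = - 'D_e21 P1 0.
  apply: (@eq_quadrant_closure _ ('D_e22 P2) (fun w => - 'D_e21 P1 w)).
  - exact: (@smoothW R _ _ 0 _ (D2 e22)).
  - by move=> w; apply: cvgN; exact: (@smoothW R _ _ 0 _ (D1 e21)).
  by move=> w w1 w2; exact: (CR2 w1 w2).2.
pose D := - 'D_e21 (comb c1 c2) 0.
have D0 : 0 < D by rewrite /D oppr_gt0; exact: normal_derive2_lt0.
(* Cauchy-Schwarz with the unit vector [(c1, c2)]: the radial derivative of [Phi] is at least as
   large as that of its projection. *)
have AB : D ^+ 2 <= 'D_e21 P1 0 ^+ 2 + 'D_e21 P2 0 ^+ 2.
  have cs (x y z : R) : z = c1 * x + c2 * y -> (- z) ^+ 2 <= x ^+ 2 + y ^+ 2.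
    move=> ->; rewrite sqrrN -subr_ge0 -[X in X - _]mul1r -{1}P0_1 -/c1 -/c2.
    have -> : (c1 ^+ 2 + c2 ^+ 2) * (x ^+ 2 + y ^+ 2) - (c1 * x + c2 * y) ^+ 2
      = (c1 * y - c2 * x) ^+ 2 by ring.
    exact: sqr_ge0.
  exact: (cs _ _ _ (derive_combE c1 c2 e21 0)).
have e0 : 0 < D / 4 by rewrite divr_gt0.
have [r1 r10 u1] := near0_ball (derive_near_unif 0 (smoothW s1) e0).
have [r2 r20 u2] := near0_ball (derive_near_unif 0 (smoothW s2) e0).
exists (Num.min r1 r2), (D / 4); split=> //; first by rewrite lt_min r10.
move=> w w'; rewrite !lt_min => /andP[w1 w2] /andP[w'1 w'2] ww'.
pose u := w.2 - w'.2.
have vE : w - w' = (0, u) by apply: injective_projections => //=; rewrite ww' subrr.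
have vu : `|w - w'| <= `|u| by rewrite vE; apply: norm_pair_le; rewrite ?normr0.
have wE : w' + (w - w') = w by rewrite addrC subrK.
have [a ha Ea] := mean_value_line w' (w - w') d1.
have [b hb Eb] := mean_value_line w' (w - w') d2.
rewrite wE in Ea Eb.
have pa := norm_segment ha w1 w'1; have pb := norm_segment hb w2 w'2.
have coordE (P : cplx2 R -> R) : differentiable P 0 ->
  'D_(w - w') P 0 = u.1 * 'D_e21 P 0 + u.2 * 'D_e22 P 0.
  move=> dP; apply: (etrans (derive_coord (w - w') dP)); rewrite vE /=.
  exact: zero_lincomb.
have F1 := etrans (coordE _ (d1 0)) (congr1 (fun z => u.1 * 'D_e21 P1 0 + u.2 * z) B1).
have F2 := etrans (coordE _ (d2 0)) (congr1 (fun z => u.1 * 'D_e21 P2 0 + u.2 * z) B2).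
have sub (x y y' n : R) : y = y' -> `|x - y| <= D / 4 * n -> n <= `|u| -> `|x - y'| <= D / 4 * `|u|.
  by move=> -> h hn; rewrite (le_trans h)// ler_pM2l.
have G1 := sub _ _ _ _ F1 (u1 _ pa (w - w')) vu.
have G2 := sub _ _ _ _ F2 (u2 _ pb (w - w')) vu.
rewrite Ea Eb.
exact: (bilipschitz_arith D0 (normr_ge0 u) AB (norm_coord2 u) G1 G2).
Qed.


(** [1 - eta . p = eta . (eta - p)] is at most [|eta - p| < d] by Cauchy-Schwarz, proved through
    Lagrange's identity. *)
Lemma comb_gt n1 n2 (p1 p2 d : R) : n1 ^+ 2 + n2 ^+ 2 = 1 -> 0 < d ->
  (p1 - n1) ^+ 2 + (p2 - n2) ^+ 2 < d ^+ 2 ->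
  [/\ `|n1 - p1| <= d, `|n2 - p2| <= d & 1 - d < n1 * p1 + n2 * p2].
Proof.
move=> hn d0 h.
have sq (x : R) : x ^+ 2 < d ^+ 2 -> `|x| < d.
  by move=> hx; rewrite -(@ltr_pXn2r _ 2)// ?nnegrE// ?ltW// real_normK ?num_real.
have h1 := sqr_ge0 (p1 - n1); have h2 := sqr_ge0 (p2 - n2).
split.
- by rewrite distrC ltW// sq//; lra.
- by rewrite distrC ltW// sq//; lra.
have : `|n1 * (n1 - p1) + n2 * (n2 - p2)| < d.
  apply: sq; apply: le_lt_trans h.
  rewrite -[leRHS]mul1r -hn -subr_ge0.
  have -> : (n1 ^+ 2 + n2 ^+ 2) * ((p1 - n1) ^+ 2 + (p2 - n2) ^+ 2)
    - (n1 * (n1 - p1) + n2 * (n2 - p2)) ^+ 2 = (n1 * (n2 - p2) - n2 * (n1 - p1)) ^+ 2 by ring.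
  exact: sqr_ge0.
move=> /ltr_normlP[_]; rewrite !mulrBr -!expr2; lra.
Qed.

Lemma normal_arith (x y d l a b : R) : 0 <= l * a -> 0 <= l * b ->
  x - y <= - l * (a + b) -> 1 - d < x -> y <= 1 -> [/\ l * a <= d & 1 - d < y].
Proof. by rewrite mulNr mulrDr; split; lra. Qed.

Lemma torus_arith (x y z q s d : R) : 1 - d < x -> 1 - d < y -> z <= 1 -> s / 4 <= q ->
  x + y <= 2 * z - q -> s <= 8 * d.
Proof. lra. Qed.

(** Projecting [w] to the torus raises [comb] by at least [l (rho_1 + rho_2)], from above [1 - d] to
    at most 1. The second conclusion says that the projection still satisfies the lower bound
    required by [torus_bound]. *)
Lemma normal_bound r l n1 n2 d (w : cplx2 R) : 0 < l ->
  (forall p, `|p| < r -> forall t, 0 <= t.1 -> 0 <= t.2 ->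
    'D_(radial_vec t) (comb n1 n2) p <= - l * (t.1 + t.2)) ->
  n1 ^+ 2 + n2 ^+ 2 = 1 -> `|w| < r -> 0 <= w.1.1 -> 0 <= w.2.1 -> 1 - d < comb n1 n2 w ->
  [/\ l * w.1.1 <= d & 1 - d < comb n1 n2 (torus_vec (w.1.2, w.2.2))].
Proof.
move=> l0 slope hn wr w1 w2 cw.
pose w0 := torus_vec (w.1.2, w.2.2).
have w0r : `|w0| < r.
  apply: le_lt_trans wr; have [k1 k2 k3 k4] := cplx2_norm_coord w.
  by rewrite /w0 /torus_vec; do !apply: norm_pair_le; rewrite ?normr0.
have wE : w - w0 = radial_vec (w.1.1, w.2.1).
  by apply: injective_projections; apply: injective_projections; rewrite /= ?subr0 ?subrr.
have [a ha] := mean_value_line w0 (w - w0) (smooth_comb n1 n2).1.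
rewrite [w0 + (w - w0)]addrC subrK => Ea.
have := slope _ (norm_segment ha wr w0r) (w.1.1, w.2.1) w1 w2.
rewrite -wE => sl.
have c1' : comb n1 n2 w0 <= 1 by apply: comb_le1.
exact: (normal_arith (mulr_ge0 (ltW l0) w1) (mulr_ge0 (ltW l0) w2) (eq_le_trans Ea sl) cw c1').
Qed.

(** At the midpoint [m] the value is at most 1, while both endpoints exceed [1 - d], so the
    concavity gain is below [2 d]. The direction [v] is half of the difference, whence
    [8 d = 4 * 2 d]. *)
Lemma torus_bound r l n1 n2 d (t t' : R * R) : 0 < l ->
  (forall p, `|p| < r -> forall t,
    'D_(torus_vec t) ('D_(torus_vec t) (comb n1 n2)) p <= - l * (t.1 ^+ 2 + t.2 ^+ 2)) ->
  n1 ^+ 2 + n2 ^+ 2 = 1 -> `|torus_vec t| < r -> `|torus_vec t'| < r ->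
  1 - d < comb n1 n2 (torus_vec t) -> 1 - d < comb n1 n2 (torus_vec t') ->
  l * (t.1 - t'.1) ^+ 2 <= 8 * d.
Proof.
move=> l0 conc hn tr tr' ct ct'.
pose m := 2^-1 *: (t + t'); pose v := 2^-1 *: (t - t').
(* For [|s| <= 1] the points of the line are convex combinations of the endpoints, hence stay in the
   ball. *)
have mvE s : torus_vec m + s *: torus_vec v =
    ((1 + s) / 2) *: torus_vec t + ((1 - s) / 2) *: torus_vec t'.
  by apply: injective_projections; apply: injective_projections;
    rewrite /= /GRing.scale /= ?mulr0 ?addr0//; field.
have seg (s : R) : `|s| <= 1 -> `|torus_vec m + s *: torus_vec v| < r.
  move=> /ler_normlP[s1' s2']; rewrite mvE.
  have k1 : 0 <= (1 + s) / 2 by lra.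
  have k2 : 0 <= (1 - s) / 2 by lra.
  apply: (le_lt_trans (ler_normD _ _)); rewrite (normrZ _ (torus_vec t)) (normrZ _ (torus_vec t')).
  rewrite (ger0_norm k1) (ger0_norm k2).
  have mx : Num.max `|torus_vec t| `|torus_vec t'| < r by rewrite gt_max tr.
  apply: le_lt_trans mx.
  have -> : Num.max `|torus_vec t| `|torus_vec t'| =
    (1 + s) / 2 * Num.max `|torus_vec t| `|torus_vec t'|
    + (1 - s) / 2 * Num.max `|torus_vec t| `|torus_vec t'| by field.
  by apply: lerD; apply: ler_wpM2l => //; rewrite le_max lexx ?orbT.
have H (s : R) : `|s| <= 1 ->
    'D_(torus_vec v) ('D_(torus_vec v) (comb n1 n2)) (torus_vec m + s *: torus_vec v)
     <= - (l * (v.1 ^+ 2 + v.2 ^+ 2)).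
  by move=> hs; have := conc _ (seg _ hs) v; rewrite mulNr.
have C := concave_midpoint (smooth_comb n1 n2) H.
have mv1 := mvE 1; have mvN := mvE (-1); rewrite scale1r in mv1; rewrite scaleN1r in mvN.
have E1 : ((1 + 1) / 2) *: torus_vec t + ((1 - 1) / 2) *: torus_vec t' = torus_vec t.
  by rewrite subrr mul0r scale0r addr0 divff// scale1r.
have E2 : ((1 + -1) / 2) *: torus_vec t + ((1 - -1) / 2) *: torus_vec t' = torus_vec t'.
  by rewrite subrr mul0r scale0r add0r opprK divff// scale1r.
have cm : comb n1 n2 (torus_vec m) <= 1 by apply: comb_le1.
have q4 : l * (t.1 - t'.1) ^+ 2 / 4 <= l * (v.1 ^+ 2 + v.2 ^+ 2).
  have -> : l * (t.1 - t'.1) ^+ 2 / 4 = l * (v.1 ^+ 2) by rewrite /v /= /GRing.scale /=; field.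
  by rewrite ler_wpM2l ?(ltW l0)// lerDl sqr_ge0.
rewrite (etrans mv1 E1) (etrans mvN E2) in C.
exact: (torus_arith ct ct' cm q4 C).
Qed.


Lemma fiber_arith (m u p q n d : R) : `|n - p| <= d -> `|n - q| <= d -> m * u <= `|p - q| ->
  m * u <= 2 * d.
Proof.
move=> h1 h2 h; apply: (le_trans h); apply: (le_trans (ler_distD n _ _)).
by rewrite distrC; lra.
Qed.

Lemma square_arith (a b l d : R) : 0 < l -> 0 <= a -> 0 <= b -> d <= 1 -> 0 < d ->
  l * a <= d -> l * b <= d -> (a - b) ^+ 2 <= l ^- 2 * d.
Proof.
move=> l0 a0 b0 dle d0 ha hb.
have {}ha : a <= d / l by rewrite ler_pdivlMr// mulrC.
have {}hb : b <= d / l by rewrite ler_pdivlMr// mulrC.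
have : (a - b) ^+ 2 <= (d / l) ^+ 2.
  by rewrite -subr_ge0 subr_sqr mulr_ge0//; lra.
move=> h; apply: (le_trans h).
by rewrite exprMn exprVn mulrC ler_wpM2l ?invr_ge0 ?sqr_ge0// expr2 ler_piMl// ltW.
Qed.

(** The depth and width bounds need [eta] close to [phi(xi)]. For [d] below a threshold this is
    forced by one point of the set; above it the unit size of the neighbourhood already gives
    them. *)
Lemma local_geometry : exists r K, [/\ 0 < r, 0 < K &
  forall n1 n2 d (w w' : cplx2 R), n1 ^+ 2 + n2 ^+ 2 = 1 -> 0 < d -> `|w| < r -> `|w'| < r ->
    0 <= w.1.1 -> 0 <= w.2.1 -> 0 <= w'.1.1 -> 0 <= w'.2.1 ->
    (P1 w - n1) ^+ 2 + (P2 w - n2) ^+ 2 < d ^+ 2 ->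
    (P1 w' - n1) ^+ 2 + (P2 w' - n2) ^+ 2 < d ^+ 2 ->
    [/\ w.1.1 <= K * d, `|w.1 - w'.1| ^+ 2 <= K * d
      & w.1 = w'.1 -> `|w.2 - w'.2| <= K * d]].
Proof.
have [l3 [r3 [k3 [l30 r30 k30 H3]]]] := radial_slope.
have [l4 [r4 [k4 [l40 r40 k40 H4]]]] := torus_concavity.
have [r5 [m5 [r50 m50 H5]]] := fiber_bilipschitz.
pose k := Num.min k3 k4.
have k0 : 0 < k by rewrite lt_min k30.
have k20 : 0 < k / 2 by rewrite divr_gt0.
have [r6 r60 H6] : exists2 r, 0 < r & forall w, `|w| < r -> `|P1 w - c1| <= k / 2.
  apply: near0_ball; have cP : P1 y @[y --> (0 : cplx2 R)] --> P1 0 by exact: (smoothW (smoothW s1)).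
  by move: cP => /cvgrPdist_le /(_ _ k20); apply: filterS => y; rewrite distrC.
have [r7 r70 H7] : exists2 r, 0 < r & forall w, `|w| < r -> `|P2 w - c2| <= k / 2.
  apply: near0_ball; have cP : P2 y @[y --> (0 : cplx2 R)] --> P2 0 by exact: (smoothW (smoothW s2)).
  by move: cP => /cvgrPdist_le /(_ _ k20); apply: filterS => y; rewrite distrC.
(* Below [k / 2] the triangle inequality gives [|n - c| <= k] in each coordinate; below 1 one has
   [d^2 <= d]. *)
pose D := Num.min (k / 2) 1.
have D0 : 0 < D by rewrite lt_min k20 ltr01.
(* One summand per use: large [d], depth, squared distance in the first variable (radial and angular
   parts), and fibre diameter. *)
pose K := 4 / D + l3^-1 + (l3 ^- 2 + 8 / l4) + 2 / m5.
have q1 : 0 < 4 / D by rewrite divr_gt0.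
have q2 : 0 < l3^-1 by rewrite invr_gt0.
have q3 : 0 < l3 ^- 2 by rewrite invr_gt0 exprn_gt0.
have q4 : 0 < 8 / l4 by rewrite divr_gt0.
have q5 : 0 < 2 / m5 by rewrite divr_gt0.
pose r := Num.min (Num.min (Num.min r3 r4) (Num.min r5 1)) (Num.min r6 r7).
exists r, K; split.
- by rewrite !lt_min r30 r40 r50 r60 r70 ltr01.
- by rewrite /K !addr_gt0.
move=> n1 n2 d w w' hn d0; rewrite !lt_min.
move=> /andP[/andP[/andP[w3 w4] /andP[w5 w11]] /andP[w6 w7]].
move=> /andP[/andP[/andP[w'3 w'4] /andP[w'5 w'11]] /andP[w'6 w'7]].
move=> wa wb wa' wb' hw hw'.
have [g1 g2 g3] := comb_gt hn d0 hw.
have [g1' g2' g3'] := comb_gt hn d0 hw'.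
have leK (x y : R) : 0 <= y -> x <= y * d -> y <= K -> x <= K * d.
  by move=> y0 hx hy; rewrite (le_trans hx)// ler_wpM2r// ltW.
(* The fibre bound requires no closeness of [eta], so it is settled before the case split on [d]. *)
have third : w.1 = w'.1 -> `|w.2 - w'.2| <= K * d.
  move=> e; apply: (leK _ (2 / m5)); [exact: ltW| |by rewrite /K; lra].
  rewrite mulrAC ler_pdivlMr// mulrC.
  have [h|h] := H5 _ _ w5 w'5 e; first exact: fiber_arith g1 g1' h.
  exact: fiber_arith g2 g2' h.
have [Dd|dD] := leP D d.
  have Dd1 : 4 <= 4 / D * d by rewrite mulrAC ler_pdivlMr// ler_pM2l.
  split=> //.
    apply: (leK _ (4 / D)); [exact: ltW| |by rewrite /K; lra].
    have [h _ _ _] := cplx2_norm_coord w; have := le_lt_trans (le_trans (ler_norm _) h) w11.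
    by lra.
  apply: (leK _ (4 / D)); [exact: ltW| |by rewrite /K; lra].
  apply: le_trans Dd1.
  have n1w : `|w.1| <= `|w| by rewrite [X in _ <= X]prod_normE le_max lexx.
  have n1w' : `|w'.1| <= `|w'| by rewrite [X in _ <= X]prod_normE le_max lexx.
  have : `|w.1 - w'.1| <= 2 by rewrite (le_trans (ler_normB _ _))//; lra.
  move=> h; have -> : 4 = (2 : R) ^+ 2 by rewrite expr2; ring.
  by rewrite ler_pXn2r// nnegrE.
have dk : d <= k / 2 by move: dD; rewrite lt_min => /andP[/ltW].
have d1' : d <= 1 by move: dD; rewrite lt_min => /andP[_ /ltW].
have near (n p c : R) : `|n - p| <= d -> `|p - c| <= k / 2 -> `|n - c| <= k.
  by move=> h1 h2; apply: (le_trans (ler_distD p _ _)); lra.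
have kk : k <= k3 /\ k <= k4 by rewrite /k !ge_min !lexx orbT.
have a1 := near _ _ _ g1 (H6 _ w6); have a2 := near _ _ _ g2 (H7 _ w7).
have n1le : `|n1| <= 1.
  by rewrite -(@ler_pXn2r _ 2)// ?nnegrE// real_normK ?num_real// expr1n -hn lerDl sqr_ge0.
have n2le : `|n2| <= 1.
  by rewrite -(@ler_pXn2r _ 2)// ?nnegrE// real_normK ?num_real// expr1n -hn lerDr sqr_ge0.
have S3 := H3 _ _ n1le n2le (le_trans a1 kk.1) (le_trans a2 kk.1).
have S4 := H4 _ _ n1le n2le (le_trans a1 kk.2) (le_trans a2 kk.2).
have [b1 b2] := normal_bound l30 S3 hn w3 wa wb g3.
have [b1' b2'] := normal_bound l30 S3 hn w'3 wa' wb' g3'.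
have tr (z : cplx2 R) : `|z| < r4 -> `|torus_vec (z.1.2, z.2.2)| < r4.
  move=> h; apply: le_lt_trans h; have [h1 h2 h3 h4] := cplx2_norm_coord z.
  by rewrite /torus_vec; do !apply: norm_pair_le; rewrite ?normr0.
have T := torus_bound l40 S4 hn (tr _ w4) (tr _ w'4) b2 b2'.
split=> //.
  apply: (leK _ l3^-1); [exact: ltW| |by rewrite /K; lra].
  by rewrite mulrC ler_pdivlMr// mulrC.
(* Both depths lie in [[0, d / l3]], so the radial part is at most [(d / l3)^2 <= l3^-2 d] as
   [d <= 1]; the angular part is at most [8 d / l4]. *)
apply: (leK _ (l3 ^- 2 + 8 / l4)); [by rewrite addr_ge0// ltW| |by rewrite /K; lra].
apply: (le_trans (norm_coord2 _)) => /=; rewrite mulrDl lerD//.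
  exact: square_arith.
by rewrite mulrAC ler_pdivlMr// mulrC.
Qed.

End Geometry.

(** * Polar lifts *)

Section Lift.
Context {R : realType}.

Lemma cabs_polar a (u : cplx R) : cabs (polar a u) = expR (- u.1).
Proof.
rewrite /cabs /polar /= !exprMn -mulrDr cos2Dsin2 mulr1 sqrtr_sqr ger0_norm//.
Qed.

Lemma sqr_cabs (z : cplx R) : cabs z ^+ 2 = z.1 ^+ 2 + z.2 ^+ 2.
Proof. by rewrite /cabs sqr_sqrtr// addr_ge0 ?sqr_ge0. Qed.

Lemma cabs_expi a : cabs (expi a : cplx R) = 1.
Proof. by rewrite /cabs /= cos2Dsin2 sqrtr1. Qed.

Lemma polar0 a : polar a (0 : cplx R) = expi a.
Proof. by rewrite /polar /= oppr0 expR0 !mul1r addr0. Qed.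

Lemma polar2_bidisc a1 a2 (w : cplx2 R) : 0 < w.1.1 -> 0 < w.2.1 -> bidisc (polar2 a1 a2 w).
Proof. by move=> h1 h2; split; rewrite /disc /= cabs_polar expR_lt1 oppr_lt0. Qed.

Lemma lipschitz1_of_derive (f g : R -> R) (x y : R) : (forall t : R, is_derive t 1 f (g t)) ->
  (forall t, `|g t| <= 1) -> `|f x - f y| <= `|x - y|.
Proof.
move=> fg g1.
have df (t : R) : differentiable (f : R -> R) t by apply/derivable1_diffP; case: (fg t).
have [c _] := mean_value_line y (x - y) df.
have -> : y + (x - y) = x by rewrite addrC subrK.
move=> ->; have -> : x - y = (x - y) *: (1 : R) by rewrite /GRing.scale /= mulr1.
rewrite (deriveZv _ _ (df _)) normrM /GRing.scale /= mulr1 ler_piMr//.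
by rewrite (@derive_val _ _ _ _ _ _ _ (fg _)).
Qed.

Lemma cos_lipschitz (x y : R) : `|cos x - cos y| <= `|x - y|.
Proof.
apply: (@lipschitz1_of_derive _ (fun t => - sin t)) => t.
by rewrite normrN ler_norml sin_geN1 sin_le1.
Qed.

Lemma sin_lipschitz (x y : R) : `|sin x - sin y| <= `|x - y|.
Proof.
apply: (@lipschitz1_of_derive _ (fun t => cos t)) => t.
by rewrite ler_norml cos_geN1 cos_le1.
Qed.

Lemma expRN_lipschitz (x y : R) : 0 <= x -> 0 <= y -> `|expR (- x) - expR (- y)| <= `|x - y|.
Proof.
wlog xy : x y / x <= y.
  move=> h x0 y0; have [/h|/ltW/h] := leP x y; first exact.
  by move=> h'; rewrite distrC [X in _ <= X]distrC; exact: h'.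
move=> x0 y0; have exy : expR (- y) <= expR (- x) by rewrite ler_expR lerN2.
rewrite ger0_norm ?subr_ge0// ler0_norm ?subr_le0// opprB.
have -> : expR (- y) = expR (- x) * expR (- (y - x)) by rewrite -expRD; congr expR; ring.
have e1 : expR (- x) <= 1 by rewrite -expR0 ler_expR oppr_le0.
have := expR_ge1Dx (- (y - x)); have := expR_ge0 (- x).
move: (expR (- x)) (expR (- (y - x))) e1 => a b a1 a0 b1.
have yx : 0 <= y - x by rewrite subr_ge0.
have -> : a - a * b = a * (1 - b) by ring.
apply: (@le_trans _ _ (a * (y - x))); first by apply: ler_wpM2l => //; lra.
by rewrite ler_piMl.
Qed.

(** Modulus and angle each contribute one [|u - u'|]. This brings the distance bounds from
    logarithmic coordinates back to the disc. *)
Lemma polar_lipschitz a (u u' : cplx R) : 0 <= u.1 -> 0 <= u'.1 ->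
  `|polar a u - polar a u'| <= 2 * `|u - u'|.
Proof.
move=> u0 u'0.
have [h1 h2] : `|u.1 - u'.1| <= `|u - u'| /\ `|u.2 - u'.2| <= `|u - u'|.
  by rewrite [`|u - u'|]prod_normE /= !le_max !lexx orbT.
have e1 : `|expR (- u.1)| <= 1 by rewrite ger0_norm ?expR_ge0// -expR0 ler_expR oppr_le0.
have key (p q : R) : `|q| <= 1 -> `|p - q| <= `|u.2 - u'.2| ->
  `|expR (- u.1) * p - expR (- u'.1) * q| <= 2 * `|u - u'|.
  move=> q1 pq; have -> : expR (- u.1) * p - expR (- u'.1) * q =
     expR (- u.1) * (p - q) + (expR (- u.1) - expR (- u'.1)) * q by ring.
  apply: (le_trans (ler_normD _ _)); rewrite !normrM.
  have -> : 2 * `|u - u'| = 1 * `|u - u'| + `|u - u'| * 1 by ring.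
  apply: lerD; apply: ler_pM => //; first exact: le_trans pq h2.
  exact: le_trans (expRN_lipschitz u0 u'0) h1.
have lip2 : `|(a + u.2) - (a + u'.2)| = `|u.2 - u'.2| by congr `|_|; ring.
apply: norm_pair_le; apply: key.
- by rewrite ler_norml cos_geN1 cos_le1.
- by rewrite -lip2 cos_lipschitz.
- by rewrite ler_norml sin_geN1 sin_le1.
- by rewrite -lip2 sin_lipschitz.
Qed.

(** A local inverse of [polar a] near [expi a]. The numerator is the imaginary part of
    [z exp(- i a)], so the arcsine is the argument of [z] relative to [a] as long as [z exp(- i a)]
    has positive real part. *)
Definition polar_lift (a : R) (z : cplx R) : cplx R :=
  (- ln (cabs z), asin ((z.2 * cos a - z.1 * sin a) / cabs z)).

(** Here [p] and [q] are the real and imaginary parts of [z exp(- i a)]; positivity of [p] fixes the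
    sign of the square root giving [cos (asin (q / m))]. *)
Lemma polar_liftK a (z : cplx R) : 0 < z.1 * cos a + z.2 * sin a ->
  polar a (polar_lift a z) = z.
Proof.
case: z => x y /=; set p := x * cos a + y * sin a; move=> p0.
set q := y * cos a - x * sin a.
have pq : p ^+ 2 + q ^+ 2 = x ^+ 2 + y ^+ 2.
  have -> : p ^+ 2 + q ^+ 2 = (x ^+ 2 + y ^+ 2) * (cos a ^+ 2 + sin a ^+ 2) by rewrite /p /q; ring.
  by rewrite cos2Dsin2 mulr1.
set m := cabs (x, y).
have m2 : m ^+ 2 = p ^+ 2 + q ^+ 2 by rewrite pq sqr_cabs.
have m0 : 0 < m.
  rewrite lt_neqAle sqrtr_ge0 andbT; apply/eqP => m00.
  by move: m2; rewrite -m00 expr0n /=; have := sqr_ge0 q; have := exprn_gt0 2 p0; lra.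
have mn0 : m != 0 by rewrite gt_eqF.
have s2 : 1 - (q / m) ^+ 2 = (p / m) ^+ 2.
  have p2 : p ^+ 2 = m ^+ 2 - q ^+ 2 by rewrite m2 addrK.
  by rewrite [RHS]expr_div_n p2; field.
have s1 : -1 <= q / m <= 1.
  rewrite -ler_norml -(@ler_pXn2r _ 2)// ?nnegrE// expr1n real_normK ?num_real//.
  by rewrite -subr_ge0 s2 sqr_ge0.
have cosE : cos (asin (q / m)) = p / m.
  by rewrite cos_asin// s2 sqrtr_sqr ger0_norm// divr_ge0// ltW.
have sinE : sin (asin (q / m)) = q / m by rewrite asinK.
rewrite /polar /polar_lift /= -/q -/m opprK lnK ?posrE// cosD sinD cosE sinE.
have -> : m * (cos a * (p / m) - sin a * (q / m)) = cos a * p - sin a * q by field.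
have -> : m * (sin a * (p / m) + cos a * (q / m)) = sin a * p + cos a * q by field.
have xE : cos a * p - sin a * q = x * (cos a ^+ 2 + sin a ^+ 2) by rewrite /p /q; ring.
have yE : sin a * p + cos a * q = y * (cos a ^+ 2 + sin a ^+ 2) by rewrite /p /q; ring.
by rewrite xE yE cos2Dsin2 !mulr1.
Qed.

Lemma continuous_cabs : continuous (@cabs R).
Proof.
move=> z; apply: (@continuous_comp _ _ _ (fun z : cplx R => z.1 ^+ 2 + z.2 ^+ 2) Num.sqrt).
  by apply: cvgD; apply: cvgM; (exact: cvg_fst || exact: cvg_snd).
exact: sqrt_continuous.
Qed.

Lemma near_polar_lift a (r : R) : 0 < r -> \forall z \near (expi a : cplx R),
  [/\ `|polar_lift a z| < r, polar a (polar_lift a z) = z & 1 / 2 <= cabs z ^+ 2].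
Proof.
move=> r0.
have c1 : z.1 @[z --> (expi a : cplx R)] --> cos a by exact: cvg_fst.
have c2 : z.2 @[z --> (expi a : cplx R)] --> sin a by exact: cvg_snd.
have cm : cabs z @[z --> (expi a : cplx R)] --> (1 : R).
  have cm : cabs z @[z --> (expi a : cplx R)] --> cabs (expi a : cplx R) by exact: continuous_cabs.
  by rewrite cabs_expi in cm.
have cl : - ln (cabs z) @[z --> (expi a : cplx R)] --> (0 : R).
  have : - ln (cabs z) @[z --> (expi a : cplx R)] --> - ln (1 : R).
    by apply: cvgN; apply: (cvg_comp _ _ cm); exact: (continuous_ln ltr01).
  by rewrite ln1 oppr0.
have cq : (z.2 * cos a - z.1 * sin a) / cabs z @[z --> (expi a : cplx R)] --> (0 : R).
  have -> : (0 : R) = (sin a * cos a - cos a * sin a) / 1.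
    by rewrite [sin a * _]mulrC subrr mul0r.
  apply: cvgM.
    by apply: cvgB; apply: cvgM => //; exact: cvg_cst.
  by apply: cvgV => //; exact: oner_neq0.
have ca : asin ((z.2 * cos a - z.1 * sin a) / cabs z) @[z --> (expi a : cplx R)] --> (0 : R).
  have : asin ((z.2 * cos a - z.1 * sin a) / cabs z) @[z --> (expi a : cplx R)] --> asin (0 : R).
    by apply: (cvg_comp _ _ cq); apply: continuous_asin; rewrite ltrN10 ltr01.
  have -> : asin (0 : R) = 0 by rewrite -[X in asin X](@sin0 R) sinK// in_itv /= oppr_le0 divr_ge0 ?pi_ge0.
  by [].
have cp : z.1 * cos a + z.2 * sin a @[z --> (expi a : cplx R)] --> (1 : R).
  by rewrite -(cos2Dsin2 a) !expr2; apply: cvgD; apply: cvgM => //; exact: cvg_cst.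
have n1 : \forall z \near (expi a : cplx R), `|- ln (cabs z)| < r.
  by move/cvgrPdist_lt : cl => /(_ _ r0); apply: filterS => z; rewrite sub0r normrN.
have n2 : \forall z \near (expi a : cplx R), `|asin ((z.2 * cos a - z.1 * sin a) / cabs z)| < r.
  by move/cvgrPdist_lt : ca => /(_ _ r0); apply: filterS => z; rewrite sub0r normrN.
have n3 : \forall z \near (expi a : cplx R), 0 < z.1 * cos a + z.2 * sin a.
  by move/cvgrPdist_lt : cp => /(_ _ ltr01); apply: filterS => z /ltr_normlP[]; lra.
(* [|z| > 3 / 4] gives [|z|^2 > 9 / 16]. The bound 1/2 later ensures that one real coordinate of [z]
   has modulus at least 1/2. *)
have n4 : \forall z \near (expi a : cplx R), 1 / 2 <= cabs z ^+ 2.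
  have h : (0 : R) < 1 / 4 by rewrite divr_gt0.
  move/cvgrPdist_lt : cm => /(_ _ h); apply: filterS => z /ltr_normlP[h1 h2].
  have : 0 <= (cabs z - 3 / 4) * (cabs z + 3 / 4) by rewrite mulr_ge0//; lra.
  by rewrite -subr_sqr; lra.
apply: filterS (filterI (filterI n1 n2) (filterI n3 n4)) => z [[h1 h2] [h3 h4]].
split; [|exact: polar_liftK|exact: h4].
by rewrite prod_normE /= gt_max h1.
Qed.

End Lift.

(** * Local geometry in the bidisc *)

Section BidiscGeometry.
Context {R : realType}.

Lemma derive_comp_polar2 (F : cplx2 R -> cplx R) (a1 a2 : R) (w v : cplx2 R) :
  (forall z, differentiable F z) ->
  'D_v (fun w => F (polar2 a1 a2 w)) w =
  'D_(cmul (- v.1.1, v.1.2) (polar a1 w.1), cmul (- v.2.1, v.2.2) (polar a2 w.2)) F (polar2 a1 a2 w).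
Proof.
move=> dF; have [dE _] := smooth_polar2 1 a1 a2.
have dFE : differentiable (F \o polar2 a1 a2) w by exact: differentiable_comp.
apply: (etrans (deriveE v dFE)); rewrite diff_comp//=.
by rewrite -(deriveE v (dE w)) derive_polar2 deriveE.
Qed.

Lemma bidisc_open : open (@bidisc R).
Proof.
have oD (f : cplx2 R -> cplx R) : continuous f -> open [set z | cabs (f z) < 1].
  move=> cf; apply: (@open_comp _ _ (fun z => cabs (f z)) [set x | x < 1]) => [z _|]; last exact: open_lt.
  by apply: (@continuous_comp _ _ _ f (@cabs R)); [exact: cf|exact: continuous_cabs].
by apply: openI; apply: oD => z; [exact: cvg_fst|exact: cvg_snd].
Qed.

(** The minus sign appears because the exponent [- rho + i theta] is minus the conjugate of
    [rho + i theta]: the change of coordinates is antiholomorphic. Derivatives of [F] are those of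
    [phi] since the two agree on an open set. *)
Lemma cauchy_riemann_polar (phi F : cplx2 R -> cplx R) (a1 a2 : R) (w v : cplx2 R) :
  holomorphic_on (@bidisc R) phi -> (forall z, differentiable F z) ->
  (forall z, bidisc z -> F z = phi z) -> 0 < w.1.1 -> 0 < w.2.1 ->
  'D_(cJ2 v) (fun w => F (polar2 a1 a2 w)) w = - cJ ('D_v (fun w => F (polar2 a1 a2 w)) w).
Proof.
move=> hol dF Fphi w1 w2.
have oB := bidisc_open.
have zB := polar2_bidisc a1 a2 w1 w2.
have [dphi hphi] := hol _ zB.
have DF h : 'D_h F (polar2 a1 a2 w) = 'd phi (polar2 a1 a2 w) h.
  apply: (etrans (@derive_near_eq _ _ _ F phi _ h _ oB zB Fphi)).
  exact: deriveE.
rewrite !derive_comp_polar2// !DF; set h := (X in _ = - cJ ('d _ _ X)).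
apply: (etrans _ (congr1 -%R (hphi h))).
apply: (etrans _ (linearN ('d phi (polar2 a1 a2 w)) (cJ2 h))).
apply: (congr1 (fun u => 'd phi (polar2 a1 a2 w) u)).
by rewrite /h /cJ2 /cJ /cmul /=; apply: injective_projections;
  apply: injective_projections => /=; ring.
Qed.

Lemma bidisc_geometry (phi F : cplx2 R -> cplx R) (a1 a2 : R) :
  holomorphic_on (@bidisc R) phi ->
  (forall z, bidisc z -> disc (phi z)) ->
  smooth_Ck 2 F -> (forall z, cl_bidisc z -> F z = phi z) ->
  circle (phi (expi a1, expi a2)) ->
  truly_2d_order2 phi a1 a2 ->
  exists (U : set (cplx2 R)) (K : R), [/\ open U, U (expi a1, expi a2), 1 <= K,
    forall z, U z -> 1 / 2 <= cabs z.1 ^+ 2 /\ 1 / 2 <= cabs z.2 ^+ 2 &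
    forall eta d (z z' : cplx2 R), circle eta -> 0 < d -> bidisc z -> bidisc z' -> U z -> U z' ->
      cabs (csub (phi z) eta) < d -> cabs (csub (phi z') eta) < d ->
    [/\ 1 - cabs z.1 ^+ 2 <= K * d, `|z.1 - z'.1| ^+ 2 <= K * d
      & z.1 = z'.1 -> `|z.2 - z'.2| <= K * d]].
Proof.
move=> hol phi_disc sF Fphi hxi [qa [qb [qc [hexp hQ]]]].
have [dF _] := sF.
have bcl (z : cplx2 R) : bidisc z -> cl_bidisc z by move=> [h1 h2]; split; exact: ltW.
pose E := polar2 a1 a2.
pose P1 w := (F (E w)).1; pose P2 w := (F (E w)).2.
have sE := smooth_polar2 2 a1 a2.
have s1 : smooth_Ck 2 P1 := smooth_comp_cplx2 sE (smooth_fst sF).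
have s2 : smooth_Ck 2 P2 := smooth_comp_cplx2 sE (smooth_snd sF).
have dFE w : differentiable (fun w => F (E w)) w.
  have [dE _] := sE; exact: (@differentiable_comp _ _ _ _ E F w (dE w) (dF _)).
have CR v (w : cplx2 R) : 0 < w.1.1 -> 0 < w.2.1 ->
    'D_(cJ2 v) P1 w = 'D_v P2 w /\ 'D_(cJ2 v) P2 w = - 'D_v P1 w.
  move=> w1 w2.
  have := @cauchy_riemann_polar phi F a1 a2 w v hol dF (fun z h => Fphi z (bcl z h)) w1 w2.
  have := derive_fst (cJ2 v) (dFE w); have := derive_snd (cJ2 v) (dFE w).
  have := derive_fst v (dFE w); have := derive_snd v (dFE w).
  have alg (x y x' y' : R) (z z' : cplx R) : y = z.2 -> x = z.1 -> y' = z'.2 -> x' = z'.1 ->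
    z' = - cJ z -> x' = y /\ y' = - x.
    by move=> -> -> -> -> ->; rewrite /cJ /= opprK.
  exact: alg.
have J11 : cJ2 e11 = e12 :> cplx2 R by rewrite /cJ2 /cJ /= oppr0.
have J21 : cJ2 e21 = e22 :> cplx2 R by rewrite /cJ2 /cJ /= oppr0.
have CR1 : forall w : cplx2 R, 0 < w.1.1 -> 0 < w.2.1 ->
    'D_e12 P1 w = 'D_e11 P2 w /\ 'D_e12 P2 w = - 'D_e11 P1 w.
  by rewrite -J11; exact: CR.
have CR2 : forall w : cplx2 R, 0 < w.1.1 -> 0 < w.2.1 ->
    'D_e22 P1 w = 'D_e21 P2 w /\ 'D_e22 P2 w = - 'D_e21 P1 w.
  by rewrite -J21; exact: CR.
(* [|phi| < 1] is known only inside; continuity of [F] extends the weak inequality to the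
   boundary. *)
have P_le1 : forall w : cplx2 R, 0 <= w.1.1 -> 0 <= w.2.1 -> P1 w ^+ 2 + P2 w ^+ 2 <= 1.
  move=> w w1 w2; rewrite -subr_le0.
  apply: (@le0_quadrant_closure _ (fun w => P1 w ^+ 2 + P2 w ^+ 2 - 1)) => // [x|x x1 x2].
    have c1 : {for x, continuous P1} by exact: (smoothW (smoothW s1)).
    have c2 : {for x, continuous P2} by exact: (smoothW (smoothW s2)).
    apply: cvgB; last exact: cvg_cst.
    by apply: cvgD; apply: cvgM.
  have zB := polar2_bidisc a1 a2 x1 x2.
  rewrite subr_le0 /P1 /P2 (Fphi _ (bcl _ zB)) -sqr_cabs.
  by rewrite -(expr1n _ 2) ler_pXn2r ?nnegrE ?sqrtr_ge0// ltW//; exact: phi_disc.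
have E0 : E 0 = (expi a1, expi a2).
  by rewrite /E /polar2 /= !polar0.
have cl0 : cl_bidisc (expi a1 : cplx R, expi a2 : cplx R) by split; rewrite /= cabs_expi.
have P0_1 : P1 0 ^+ 2 + P2 0 ^+ 2 = 1.
  by rewrite /P1 /P2 E0 Fphi// -sqr_cabs hxi expr1n.
have Etor t : E (torus_vec t) = (expi (a1 + t.1), expi (a2 + t.2)).
  by rewrite /E /polar2 /polar /= oppr0 expR0 !mul1r.
have P_expand : forall e, 0 < e -> exists2 r, 0 < r & forall t : R * R, `|t| < r ->
    `|P1 0 * P1 (torus_vec t) + P2 0 * P2 (torus_vec t) - (1 - qform qa qb qc t)| <= e * `|t| ^+ 2.
  move=> e e0; have := hexp e e0 => /nbhs_ballP[r /= r0 hr]; exists r => // t tr.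
  have := hr t; rewrite -ball_normE /= sub0r normrN => /(_ tr).
  rewrite /psi /cmul /cconj /= /P1 /P2 Etor E0 !Fphi ?mulNr ?opprK//.
  by split; rewrite /= cabs_expi.
have [r [K [r0 K0 geo]]] := local_geometry s1 s2 P_le1 P0_1 CR1 CR2 hQ P_expand.
pose good a (z : cplx R) :=
  [/\ `|polar_lift a z| < r, polar a (polar_lift a z) = z & 1 / 2 <= cabs z ^+ 2].
pose U := [set z : cplx2 R | (good a1)° z.1 /\ (good a2)° z.2].
have gU z : U z -> good a1 z.1 /\ good a2 z.2.
  by move=> [/interior_subset h1 /interior_subset h2].
(* The Lipschitz constant 2 of [polar] is squared in the width bound, which gives [4 K]; it also
   covers [1 - exp(- 2 rho) <= 2 rho]. The extra 1 provides [1 <= K], used when powers of the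
   constant are bounded uniformly in [beta]. *)
exists U, (4 * K + 1); split.
- have oD (A : set (cplx R)) (f : cplx2 R -> cplx R) : continuous f -> open [set z | A° (f z)].
    by move=> cf; apply: (@open_comp _ _ f A°) => [z _|]; [exact: cf|exact: open_interior].
  by apply: openI; apply: oD => z; [exact: cvg_fst|exact: cvg_snd].
- by split; exact: near_polar_lift.
- by rewrite lerDr mulr_ge0// ltW.
- by move=> z /gU[[_ _ h1] [_ _ h2]].
move=> eta d z z' heta d0 zB z'B /gU[[l1 p1 h1] [l2 p2 h2]] /gU[[l1' p1' h1'] [l2' p2' h2']] hz hz'.
pose w : cplx2 R := (polar_lift a1 z.1, polar_lift a2 z.2).
pose w' : cplx2 R := (polar_lift a1 z'.1, polar_lift a2 z'.2).
have wz : E w = z by apply: injective_projections.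
have wz' : E w' = z' by apply: injective_projections.
have wr : `|w| < r by rewrite prod_normE gt_max l1.
have wr' : `|w'| < r by rewrite prod_normE gt_max l1'.
have ln0 a (x : cplx R) : cabs x < 1 -> 0 <= (polar_lift a x).1.
  by move=> x1; rewrite /= oppr_ge0 ln_le0// ltW.
have sqe (y : cplx2 R) x : E x = y -> bidisc y -> cabs (csub (phi y) eta) < d ->
    (P1 x - eta.1) ^+ 2 + (P2 x - eta.2) ^+ 2 < d ^+ 2.
  move=> xy yB hy; rewrite /P1 /P2 xy (Fphi _ (bcl _ yB)).
  have -> : ((phi y).1 - eta.1) ^+ 2 + ((phi y).2 - eta.2) ^+ 2 = cabs (csub (phi y) eta) ^+ 2.
    by rewrite sqr_cabs.
  by rewrite ltr_pXn2r// nnegrE ?sqrtr_ge0// ltW.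
have eta1 : eta.1 ^+ 2 + eta.2 ^+ 2 = 1 by rewrite -sqr_cabs heta expr1n.
have [g1 g2 g3] := geo _ _ _ w w' eta1 d0 wr wr' (ln0 _ _ zB.1) (ln0 _ _ zB.2)
  (ln0 _ _ z'B.1) (ln0 _ _ z'B.2) (sqe _ _ wz zB hz) (sqe _ _ wz' z'B hz').
have Kd : 0 <= K * d by rewrite mulr_ge0// ltW.
have KdE : (4 * K + 1) * d = 4 * (K * d) + d by ring.
split; rewrite KdE.
- have -> : cabs z.1 = expR (- w.1.1) by rewrite -[in LHS]p1 cabs_polar.
  have := expR_ge1Dx (- w.1.1); have := ln0 a1 _ zB.1; rewrite -/w.1.1.
  move: g1 Kd d0; move: (w.1.1) (K * d) (expR _) => x y e g1 Kd d0 x0 hx.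
  have := sqr_ge0 (1 - e); lra.
- have := polar_lipschitz a1 (ln0 a1 _ zB.1) (ln0 a1 _ z'B.1); rewrite p1 p1' => lip.
  have : `|z.1 - z'.1| ^+ 2 <= (2 * `|w.1 - w'.1|) ^+ 2.
    by rewrite ler_pXn2r// nnegrE// mulr_ge0.
  by rewrite exprMn; move: g2; move: (`|w.1 - w'.1| ^+ 2) => q g2; lra.
- move=> zz.
  have ww : w.1 = w'.1 by rewrite /w /w' /= zz.
  have := polar_lipschitz a2 (ln0 a2 _ zB.2) (ln0 a2 _ z'B.2); rewrite p2 p2' => lip.
  apply: (le_trans lip); have := g3 ww; rewrite -/w.2 -/w'.2; lra.
Qed.
End BidiscGeometry.

(** * Measure and integration *)

Section Fubini.
Context {R : realType}.
Notation mu := (@lebesgue_measure R).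
Lemma leb2_sigma_finite : sigma_finite setT (@leb2 R).
Proof.
pose I (n : nat) : set (measurableTypeR R) := `[(- n%:R)%R, n%:R%R]%classic.
have mI n : measurable (I n) by exact: measurable_itv.
have Ioo n : (mu (I n) < +oo)%E.
  have -> := @lebesgue_measure_itv R `[(- n%:R)%R, n%:R%R]%R.
  by case: ifP => // _; rewrite /= -EFinD ltry.
exists (fun n => I n `*` I n) => [|n].
  apply/seteqP; split=> // -[x y] _.
  pose n := (Num.truncn (`|x| + `|y|)).+1.
  have nxy : `|x| + `|y| < n%:R by exact: truncnS_gt.
  have x0 := normr_ge0 x; have y0 := normr_ge0 y.
  by exists n => //; split; rewrite /I /= in_itv /= -ler_norml; lra.
split; first exact: measurableX.
rewrite /leb2 product_measure1E//.
by apply: lte_mul_pinfty; rewrite ?measure_ge0 ?ge0_fin_numE ?measure_ge0 ?Ioo.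
Qed.

(* For a product of two sigma-finite measures the library's canonical structure search
   only finds the instance for subprobabilities, whence the registration on leb2. *)
HB.instance Definition _ := Measure.copy (@leb2 R) (mu \x mu)%E.
HB.instance Definition _ := Measure_isSigmaFinite.Build _ _ _ (@leb2 R) leb2_sigma_finite.

Lemma fubini_leb2 (f : cplx R -> \bar R) :
 measurable_fun setT f -> (forall z, (0 <= f z)%E) ->
 (\int[@leb2 R]_z f z = \int[mu]_x \int[mu]_y f (x,y))%E.
Proof. by move=> mf f0; exact: (@fubini_tonelli1 _ _ _ _ R mu mu f mf f0). Qed.

Lemma fubini_leb2_sym (f : cplx R -> \bar R) :
 measurable_fun setT f -> (forall z, (0 <= f z)%E) ->
 (\int[@leb2 R]_z f z = \int[mu]_y \int[mu]_x f (x,y))%E.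
Proof. by move=> mf f0; exact: (@fubini_tonelli2 _ _ _ _ R mu mu f mf f0). Qed.

Lemma fubini_leb4 (f : cplx2 R -> \bar R) :
 measurable_fun setT f -> (forall x, (0 <= f x)%E) ->
 (\int[@leb4 R]_z f z = \int[@leb2 R]_z1 \int[@leb2 R]_z2 f (z1,z2))%E.
Proof. by move=> mf f0; exact: (@fubini_tonelli1 _ _ _ _ R (@leb2 R) (@leb2 R) f mf f0). Qed.
End Fubini.

(** * Open sets are measurable for the product sigma-algebra *)

Section OpenMeasurable.
Context {R : realType}.

(** [op] plays the role of the family of open sets. Being a bare predicate on a measurable type, it
    can be passed through products twice without a topology on the product. *)
Definition countable_measurable_base d (T : measurableType d) (op : set (set T)) :=
  exists B : nat -> set T, (forall n, measurable (B n)) /\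
  forall U x, op U -> U x -> exists2 n, B n x & B n `<=` U.
Lemma open_measurable_countable d (T : measurableType d) (op : set (set T)) U :
  countable_measurable_base op -> op U -> measurable U.
Proof.
move=> [B [mB HB]] oU.
have -> : U = \bigcup_(n in [set n | B n `<=` U]) B n.
  apply/seteqP; split=> [x Ux|x [n /= + Bx]]; last exact.
  by have [n Bn BU] := HB _ _ oU Ux; exists n.
by apply: bigcup_measurable => n _; exact: mB.
Qed.

(** Balls with rational centre and radius, numbered by [pickle]; the integers that are no code give
    the empty set. *)
Lemma base_real : @countable_measurable_base _ (measurableTypeR R) (@open R).
Proof.
exists (fun n => if unpickle n is Some q then ball (@ratr R q.1) (@ratr R q.2) else set0).
split=> [n|U x oU Ux].
  by case: unpickle => [q|//]; exact: measurable_ball.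
have [c [r /= [xB BU]]] := open_subball_rat oU (mem_set Ux).
by exists (pickle (c, r)); rewrite pickleK//; exact: set_mem.
Qed.

Lemma base_prod d1 d2 (T1 : measurableType d1) (T2 : measurableType d2)
    (op1 : set (set T1)) (op2 : set (set T2)) :
  countable_measurable_base op1 -> countable_measurable_base op2 ->
  countable_measurable_base [set U : set (T1 * T2) | forall x, U x ->
    exists A B, [/\ op1 A, op2 B, A x.1, B x.2 & A `*` B `<=` U]].
Proof.
move=> [B1 [mB1 HB1]] [B2 [mB2 HB2]].
exists (fun n => if unpickle n is Some q then B1 q.1 `*` B2 q.2 else set0).
split=> [n|U x oU Ux].
  by case: unpickle => [q|//]; exact: measurableX.
have [A [B [oA oB Ax Bx ABU]]] := oU _ Ux.
have [n n1 n2] := HB1 _ _ oA Ax; have [m m1 m2] := HB2 _ _ oB Bx.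
exists (pickle (n, m)); rewrite pickleK//=.
by move=> y [/n2 ? /m2 ?]; exact: ABU.
Qed.

Lemma open_rect (S1 S2 : topologicalType) (U : set (S1 * S2)) : open U ->
  forall x, U x -> exists A B, [/\ open A, open B, A x.1, B x.2 & A `*` B `<=` U].
Proof.
move=> oU [x y] Uxy; have : nbhs (x, y) U by exact: open_nbhs_nbhs.
move=> [[A B] /= [nA nB] ABU].
exists A°, B°; split; [exact: open_interior..|exact: nA|exact: nB|].
by move=> z [/interior_subset ? /interior_subset ?]; exact: ABU.
Qed.

Lemma open_measurable_cplx2 (U : set (cplx2 R)) : open U ->
  @measurable _ ((measurableTypeR R * measurableTypeR R) * (measurableTypeR R * measurableTypeR R))%type U.
Proof.
have b2 := base_prod base_real base_real.
move=> oU; apply: (open_measurable_countable (base_prod b2 b2)) => x Ux.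
have [A [B [oA oB Ax Bx AB]]] := open_rect oU Ux.
by exists A, B; split=> //; exact: open_rect.
Qed.

End OpenMeasurable.

(** * One-dimensional integrals with an endpoint singularity *)

Section OneDim.
Context {R : realType}.
Notation mu := (@lebesgue_measure R).

(** [f] may blow up at the endpoints, so the fundamental theorem is used on compact subintervals,
    where the increments of [F] are bounded by [M], and monotone convergence concludes. *)
Lemma integral_le_of_derive (a b M : R) (f F : R -> R) : a < b ->
  (forall x : R, a < x < b -> is_derive x 1 F (f x)) ->
  (forall x : R, a < x < b -> {for x, continuous f}) ->
  (forall x, a < x < b -> 0 <= f x) ->
  (forall x y, a < x -> x <= y -> y < b -> F y - F x <= M) ->
  (\int[mu]_(x in `]a, b[) (f x)%:E <= M%:E)%E.
Proof.
move=> ab dF cf f0 FM.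
(* The shift by 3 gives [h n <= (b - a) / 3], so the subinterval is nondegenerate already for
   [n = 0]. *)
pose h n : R := (b - a) / (n.+3)%:R.
have ba0 : 0 < b - a by rewrite subr_gt0.
have h0 n : 0 < h n by rewrite divr_gt0.
have h3 n : h n <= (b - a) / 3 by rewrite /h ler_pM2l// lef_pV2 ?posrE// ler_nat.
have in_ n x : (x \in `[(a + h n), (b - h n)]%R) -> a < x < b.
  by rewrite in_itv /= => /andP[x1 x2]; have := h0 n; lra.
pose I n : set R := `[(a + h n), (b - h n)]%classic.
have -> : `]a, b[%classic = \bigcup_n I n.
  apply/seteqP; split=> x /=; last first.
    by move=> [n _ /in_]; rewrite ?in_itv.
  rewrite ?in_itv /= => /andP[ax xb].
  have e0 : 0 < Num.min (x - a) (b - x) by rewrite lt_min !subr_gt0 ax.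
  have [n hn] : exists n, h n <= Num.min (x - a) (b - x).
    pose e := Num.min (x - a) (b - x).
    exists (Num.truncn ((b - a) / e)); rewrite /h ler_pdivrMr// mulrC -ler_pdivrMr//.
    apply/ltW/(lt_le_trans (truncnS_gt _)); rewrite ler_nat; exact: (leqW (leqW (leqnn _))).
  move: hn; rewrite le_min => /andP[h1 h2].
  have k1 : a + h n <= x by lra.
  have k2 : x <= b - h n by lra.
  by exists n => //; rewrite /I /= in_itv /= k1 k2.
have hdec n m : (n <= m)%N -> h m <= h n.
  by move=> nm; rewrite /h ler_pM2l// lef_pV2 ?posrE// ler_nat.
have cfI n : {within I n, continuous f}.
  apply: continuous_in_subspaceT => x; rewrite inE => /in_; exact: cf.
have C : (\int[mu]_(x in I i) (f x)%:E @[i --> \oo] --> \int[mu]_(x in \bigcup_i I i) (f x)%:E)%E.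
  apply: ge0_nondecreasing_set_cvg_integral.
  - move=> n m nm; apply/subsetPset; rewrite /I.
    have hnm := hdec _ _ nm.
    by apply: subset_itv; rewrite bnd_simp; lra.
  - by move=> n; exact: measurable_itv.
  - move=> n; apply/measurable_EFinP; apply: subspace_continuous_measurable_fun.
      exact: measurable_itv.
    exact: cfI.
  - by move=> n x /in_ /f0; rewrite lee_fin.
apply: (cvge_le _ C); apply: nearW => n.
  have abn : a + h n < b - h n by have := h3 n; lra.
  rewrite (continuous_FTC2 abn (cfI n) (F := F)).
  + rewrite -EFinB lee_fin; apply: FM.
    * by rewrite ltrDl.
    * exact: ltW.
    * by rewrite ltrBlDr ltrDl.
  + split.
    * by move=> x /subset_itv_oo_cc /in_ /dF [].
    * apply: cvg_at_right_filter; apply: differentiable_continuous; apply/derivable1_diffP.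
      by have [] := dF (a + h n) _; last by []; have := h0 n; have := h3 n; lra.
    * apply: cvg_at_left_filter; apply: differentiable_continuous; apply/derivable1_diffP.
      by have [] := dF (b - h n) _; last by []; have := h0 n; have := h3 n; lra.
  + move=> x /subset_itv_oo_cc /in_ /dF dFx.
    by rewrite derive1E (@derive_val _ _ _ _ _ _ _ dFx).
Qed.

(** With [p = beta + 1], the factor [p] of the density cancels the [1 / p] of the antiderivative: no
    constant depending on [beta] remains. *)
Lemma integral_powR_left (b s p : R) : 0 < s -> 0 < p ->
  (\int[mu]_(x in `](b - s)%R, b[) (p * (b - x) `^ (p - 1))%:E <= (s `^ p)%:E)%E.
Proof.
move=> s0 p0.
apply: (@integral_le_of_derive _ _ _ _ (fun x => - (b - x) `^ p)); first by lra.
- move=> x /andP[x1 x2].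
  have bx : 0 < b - x by lra.
  have d1 : is_derive x 1 (fun x : R => b - x) (- 1).
    have -> : (fun x : R => b - x) = cst b - id by [].
    by apply: is_derive_eq; rewrite sub0r.
  have := is_deriveN (@is_derive1_comp _ (fun y => y `^ p) (fun x => b - x) x _ _ (is_derive1_powR p bx) d1).
  by congr is_derive; rewrite mulrN1 opprK.
- move=> x /andP[x1 x2].
  have bx : 0 < b - x by lra.
  apply: cvgM; first exact: cvg_cst.
  apply: (@continuous_comp _ _ _ (fun x => b - x) (fun y => y `^ (p - 1))).
    by apply: cvgB; [exact: cvg_cst|exact: cvg_id].
  apply: differentiable_continuous; apply/derivable1_diffP.
  by have [] := is_derive1_powR (p - 1) bx.
- by move=> x _; rewrite mulr_ge0 ?powR_ge0// ltW.
- move=> x y x1 xy yb; have y0 := powR_ge0 (b - y) p.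
  have : (b - x) `^ p <= s `^ p by rewrite ge0_ler_powR ?nnegrE ?ltW//; lra.
  by rewrite opprK; lra.
Qed.

Lemma integral_powR_right (b s p : R) : 0 < s -> 0 < p ->
  (\int[mu]_(x in `](- b)%R, (- b + s)%R[) (p * (b + x) `^ (p - 1))%:E <= (s `^ p)%:E)%E.
Proof.
move=> s0 p0.
apply: (@integral_le_of_derive _ _ _ _ (fun x => (b + x) `^ p)); first by lra.
- move=> x /andP[x1 x2].
  have bx : 0 < b + x by lra.
  have d1 : is_derive x 1 (fun x : R => b + x) 1.
    have -> : (fun x : R => b + x) = cst b + id by [].
    by apply: is_derive_eq; rewrite add0r.
  have := @is_derive1_comp _ (fun y => y `^ p) (fun x => b + x) x _ _ (is_derive1_powR p bx) d1.
  by congr is_derive; rewrite mulr1.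
- move=> x /andP[x1 x2].
  have bx : 0 < b + x by lra.
  apply: cvgM; first exact: cvg_cst.
  apply: (@continuous_comp _ _ _ (fun x => b + x) (fun y => y `^ (p - 1))).
    by apply: cvgD; [exact: cvg_cst|exact: cvg_id].
  apply: differentiable_continuous; apply/derivable1_diffP.
  by have [] := is_derive1_powR (p - 1) bx.
- by move=> x _; rewrite mulr_ge0 ?powR_ge0// ltW.
- move=> x y x1 xy yb; have y0 := powR_ge0 (b + x) p.
  have : (b + y) `^ p <= s `^ p by rewrite ge0_ler_powR ?nnegrE ?ltW//; lra.
  by lra.
Qed.
End OneDim.

(** * Integrals over boundary caps *)

Section Strip.
Context {R : realType}.
Notation mu := (@lebesgue_measure R).
Notation T2 := (measurableTypeR R * measurableTypeR R)%type.

Lemma measurable_sublevel d (T : measurableType d) (g : T -> R) (c : R) :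
  measurable_fun setT g ->
  [/\ measurable [set z | g z <= c], measurable [set z | c <= g z] & measurable [set z | g z < c]].
Proof.
move=> mg; split.
- have -> : [set z | g z <= c] = setT `&` g @^-1` `]-oo, c]%classic.
    by apply/seteqP; split=> z /=; rewrite in_itv /= ?setTI //=; case.
  exact: mg.
- have -> : [set z | c <= g z] = setT `&` g @^-1` `[c, +oo[%classic.
    by apply/seteqP; split=> z /=; rewrite in_itv /= andbT //=; case.
  exact: mg.
- have -> : [set z | g z < c] = setT `&` g @^-1` `]-oo, c[%classic.
    by apply/seteqP; split=> z /=; rewrite in_itv /= //=; case.
  exact: mg.
Qed.

Let q (z : T2) : R := z.1 ^+ 2 + z.2 ^+ 2.

Let measurable_q : measurable_fun setT q.
Proof.
by apply: measurable_funD; apply: measurable_funX; [exact: measurable_fst|exact: measurable_snd].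
Qed.

(** The condition [1 / 2 <= |z.1|] selects the part of the annulus where horizontal lines cross the
    circle transversally, so that on a row the distance to the circle is comparable to the distance
    to the end of the chord. *)
Definition strip (s r c : R) : set (cplx R) :=
  [set z | [/\ 1 / 2 <= `|z.1|, z.1 ^+ 2 + z.2 ^+ 2 < 1, 1 - (z.1 ^+ 2 + z.2 ^+ 2) <= s
             & `|z.2 - c| <= r]].

Lemma measurable_strip s r c : @measurable _ T2 (strip s r c).
Proof.
have -> : strip s r c = [set z : T2 | 1 / 2 <= `|z.1|] `&` [set z | q z < 1]
   `&` [set z | 1 - s <= q z] `&` [set z : T2 | `|z.2 - c| <= r].
  apply/seteqP; split=> z /=.
    by move=> [h1 h2 h3 h4]; split=> //; split=> //; rewrite /q; lra.
  by move=> [[[h1 h2] h3] h4]; split=> //; move: h3; rewrite /q; lra.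
have m1 : measurable_fun setT (fun z : T2 => `|z.1|).
  by apply: measurableT_comp; [exact: normr_measurable|exact: measurable_fst].
have m2 : measurable_fun setT (fun z : T2 => `|z.2 - c|).
  apply: measurableT_comp; first exact: normr_measurable.
  by apply: measurable_funB; [exact: measurable_snd|exact: measurable_cst].
have [_ k1 _] := measurable_sublevel (1 / 2) m1.
have [_ _ k2] := measurable_sublevel 1 measurable_q.
have [_ k3 _] := measurable_sublevel (1 - s) measurable_q.
have [k4 _ _] := measurable_sublevel r m2.
by apply: measurableI => //; apply: measurableI => //; exact: measurableI.
Qed.

(** For [p = beta + 1] this is [pi] times the density of [dA_beta]. *)
Definition weight (p : R) (z : cplx R) : R := p * (1 - (z.1 ^+ 2 + z.2 ^+ 2)) `^ (p - 1).

Lemma measurable_weight p : measurable_fun setT (weight p : T2 -> R).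
Proof.
apply: measurable_funM; first exact: measurable_cst.
apply: (measurableT_comp (measurable_powR (p - 1))).
by apply: measurable_funB; [exact: measurable_cst|exact: measurable_q].
Qed.

Definition strip_weight p s r c (z : cplx R) : R := weight p z * \1_(strip s r c) z.

Lemma measurable_strip_weight p s r c : measurable_fun setT (strip_weight p s r c : T2 -> R).
Proof.
apply: measurable_funM; first exact: measurable_weight.
by apply: measurable_indic; exact: measurable_strip.
Qed.

Lemma strip_weight_ge0 p s r c z : 0 < p -> 0 <= strip_weight p s r c z.
Proof. by move=> p0; rewrite mulr_ge0// mulr_ge0 ?powR_ge0// ltW. Qed.

Lemma powR_le_antitone (x y p : R) : 0 < p <= 1 -> 0 < x -> x <= y ->
  y `^ (p - 1) <= x `^ (p - 1).
Proof.
move=> /andP[p0 p1] x0 xy; have y0 : 0 < y by exact: lt_le_trans xy.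
have -> : p - 1 = - (1 - p) by rewrite opprB.
rewrite !powRN lef_pV2 ?posrE ?powR_gt0// ge0_ler_powR ?nnegrE ?subr_ge0//; exact: ltW.
Qed.

(** On the row of height [y], with half chord [b], [1 - |z|^2 = (b - |x|) (b + |x|)] and
    [b + |x| >= 1]. Hence [b - |x| <= s], and the weight is at most [p (b - |x|)^(p - 1)] because
    the exponent is nonpositive; the two ends of the chord are integrated separately. *)
Lemma strip_weight_row p s r c (y : R) : 0 < p <= 1 -> 0 < s ->
  (\int[mu]_x (strip_weight p s r c (x, y))%:E <= (4 * s `^ p * \1_(`[c - r, c + r]%classic) y)%:E)%E.
Proof.
move=> p01 s0; have /andP[p0 p1] := p01.
(* When [y^2 > 1] the root is 0 by convention, and the row of the strip is empty. *)
pose b := Num.sqrt (1 - y ^+ 2).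
have [yc|yc] := boolP (y \in `[c - r, c + r]%R); last first.
  rewrite indicE memNset; last by move=> h; move: yc; rewrite h.
  rewrite mulr0 integral0_eq// => x _; rewrite /strip_weight indicE memNset ?mulr0//.
  move=> [_ _ _ /= h]; move: yc; rewrite in_itv /=; move: h => /ler_normlP[h1 h2].
  by move/negP; apply; apply/andP; split; lra.
rewrite indicE mem_set// mulr1.
(* Length [2 s] puts depths up to [s] strictly inside an open interval; the cost is
   [(2 s)^p <= 2 s^p], as [p <= 1]. *)
pose I1 : set (measurableTypeR R) := `](b - 2 * s)%R, b[%classic.
pose I2 : set (measurableTypeR R) := `](- b)%R, (- b + 2 * s)%R[%classic.
pose f1 (x : measurableTypeR R) : \bar R := (p * (b - x) `^ (p - 1))%:E.
pose f2 (x : measurableTypeR R) : \bar R := (p * (b + x) `^ (p - 1))%:E.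
have mI1 : measurable I1 by exact: measurable_itv.
have mI2 : measurable I2 by exact: measurable_itv.
have mf1 : measurable_fun setT f1.
  apply/measurable_EFinP; apply: measurable_funM; first exact: measurable_cst.
  apply: (measurableT_comp (measurable_powR (p - 1))).
  by apply: measurable_funB; [exact: measurable_cst|exact: measurable_id].
have mf2 : measurable_fun setT f2.
  apply/measurable_EFinP; apply: measurable_funM; first exact: measurable_cst.
  apply: (measurableT_comp (measurable_powR (p - 1))).
  by apply: measurable_funD; [exact: measurable_cst|exact: measurable_id].
have mg1 : measurable_fun setT (f1 \_ I1).
  by apply/(measurable_restrictT f1 mI1); exact: measurable_funTS.
have mg2 : measurable_fun setT (f2 \_ I2).
  by apply/(measurable_restrictT f2 mI2); exact: measurable_funTS.
have f10 x : (0 <= f1 x)%E by rewrite lee_fin mulr_ge0 ?powR_ge0// ltW.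
have f20 x : (0 <= f2 x)%E by rewrite lee_fin mulr_ge0 ?powR_ge0// ltW.
have g10 x : (0 <= (f1 \_ I1) x)%E by rewrite patchE; case: ifP.
have g20 x : (0 <= (f2 \_ I2) x)%E by rewrite patchE; case: ifP.
have dom x : ((strip_weight p s r c (x, y))%:E <= (f1 \_ I1) x + (f2 \_ I2) x)%E.
  rewrite /strip_weight indicE; have [|_] := boolP ((x, y) \in strip s r c); last first.
    by rewrite mulr0 adde_ge0.
  rewrite inE mulr1 => -[/= hx hq hs _].
  have y2 := sqr_ge0 y; have x2 := sqr_ge0 x.
  have b0 : 0 <= b by exact: sqrtr_ge0.
  have bE : b ^+ 2 = 1 - y ^+ 2 by rewrite sqr_sqrtr//; lra.
  have xb : `|x| < b.
    by rewrite -(@ltr_pXn2r _ 2) ?nnegrE// real_normK ?num_real// bE; lra.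
  have qE : 1 - (x ^+ 2 + y ^+ 2) = (b - `|x|) * (b + `|x|).
    by rewrite -subr_sqr bE real_normK ?num_real//; ring.
  have t0 : 0 < b - `|x| by rewrite subr_gt0.
  have tq : b - `|x| <= 1 - (x ^+ 2 + y ^+ 2) by rewrite qE ler_peMr ?(ltW t0)//; lra.
  have ts : b - `|x| < 2 * s by lra.
  have W : weight p (x, y) <= p * (b - `|x|) `^ (p - 1).
    by rewrite /weight /= ler_pM2l// powR_le_antitone.
  have [x0|x0] := leP 0 x.
    apply: (@le_trans _ _ (f1 x)).
      by rewrite lee_fin (le_trans W)// ger0_norm.
    have xI : I1 x.
      move: ts xb; rewrite ger0_norm// => ts xb.
      have k1 : b - 2 * s < x by lra.
      by rewrite /I1 /= in_itv /= k1 xb.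
    by rewrite patchE mem_set// leeDl.
  apply: (@le_trans _ _ (f2 x)).
    by rewrite lee_fin (le_trans W)// ltr0_norm// opprK.
  have xI : I2 x.
    move: ts xb; rewrite ltr0_norm// => ts xb.
    have k1 : - b < x by lra.
    have k2 : x < - b + 2 * s by lra.
    by rewrite /I2 /= in_itv /= k1 k2.
  by rewrite [X in (_ <= _ + X)%E]patchE mem_set// leeDr.
have ms : measurable_fun setT (fun x : measurableTypeR R => (strip_weight p s r c (x, y))%:E).
  apply/measurable_EFinP.
  exact: (measurableT_comp (measurable_strip_weight p s r c)
    (@pair2_measurable _ _ (measurableTypeR R) (measurableTypeR R) y)).
apply: (@le_trans _ _ (\int[mu]_x ((f1 \_ I1) x + (f2 \_ I2) x))%E).
  apply: ge0_le_integral => //.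
  - by move=> x _; rewrite lee_fin strip_weight_ge0.
  - exact: emeasurable_funD.
rewrite ge0_integralD// -!integral_mkcond.
have s20 : 0 < 2 * s by rewrite mulr_gt0.
have i1 := integral_powR_left b s20 p0; have i2 := integral_powR_right b s20 p0.
apply: (le_trans (leeD i1 i2)); rewrite -EFinD lee_fin powRM ?(ltW s0)//.
have : (2 : R) `^ p <= 2 by rewrite -[leRHS]powRr1// ler_powR// ler1n.
have := powR_ge0 s p; move: (s `^ p) (2 `^ p) => u v u0 v2.
by have := ler_wpM2r u0 v2; lra.
Qed.

End Strip.

(** * Planar cap integrals and the volume estimate *)

Section Final.
Context {R : realType}.
Notation mu := (@lebesgue_measure R).
Notation T2 := (measurableTypeR R * measurableTypeR R)%type.

Lemma measurable_band (c r : R) : measurable_fun (setT : set (measurableTypeR R))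
  (fun y : measurableTypeR R => \1_(`[(c - r)%R, (c + r)%R]%classic : set (measurableTypeR R)) y : R).
Proof.
exact: (@measurable_indic _ (measurableTypeR R) R setT (`[(c - r)%R, (c + r)%R]%classic) (measurable_itv _)).
Qed.

Lemma integral_band (k c r : R) : 0 <= k -> 0 < r ->
  (\int[mu]_y (k * \1_(`[(c - r)%R, (c + r)%R]%classic) y)%:E = (k * (2 * r))%:E)%E.
Proof.
move=> k0 r0; under eq_integral do rewrite EFinM.
rewrite ge0_integralZl_EFin//; last by apply/measurable_EFinP; exact: measurable_band.
rewrite (integral_indic mu measurableT (measurable_itv `[(c - r)%R, (c + r)%R]%R)).
rewrite setIT; have E := @lebesgue_measure_itv R `[(c - r)%R, (c + r)%R]%R.
apply: (etrans (congr1 (fun x => k%:E * x)%E E)).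
rewrite /= lte_fin ifT; last by lra.
by rewrite -EFinD -EFinM; congr (_%:E); ring.
Qed.

Lemma strip_weight_integral p s r c : 0 < p <= 1 -> 0 < s -> 0 < r ->
  (\int[@leb2 R]_z (strip_weight p s r c z)%:E <= (8 * s `^ p * r)%:E)%E.
Proof.
move=> p01 s0 r0; have /andP[p0 p1] := p01.
have mF : measurable_fun (setT : set T2) (fun z : T2 => (strip_weight p s r c z)%:E).
  by apply/measurable_EFinP; exact: measurable_strip_weight.
have F0 (z : T2) : (0 <= (strip_weight p s r c z)%:E)%E by rewrite lee_fin strip_weight_ge0.
rewrite (fubini_leb2_sym mF F0).
apply: (@le_trans _ _ (\int[mu]_y (4 * s `^ p * \1_(`[(c - r)%R, (c + r)%R]%classic) y)%:E)%E).
  apply: ge0_le_integral => //.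
  - by move=> y _; apply: integral_ge0.
  - have M := @measurable_fun_fubini_tonelli_G _ _ (measurableTypeR R) (measurableTypeR R)
      R mu _ mF F0.
    exact: M.
  - apply/measurable_EFinP; apply: measurable_funM; first exact: measurable_cst.
    exact: measurable_band.
  - by move=> y _; exact: strip_weight_row.
rewrite integral_band ?mulr_ge0 ?powR_ge0// lee_fin.
by rewrite le_eqVlt; apply/orP; left; apply/eqP; ring.
Qed.

Lemma measurable_strip_weight_swap p s r c :
  measurable_fun (setT : set T2) (fun z : T2 => strip_weight p s r c (z.2, z.1)).
Proof.
have h : measurable_fun (setT : set T2) (fun z : T2 => (z.2, z.1) : T2).
  by apply: measurable_fun_pair; [exact: measurable_snd|exact: measurable_fst].
exact: (measurableT_comp (measurable_strip_weight p s r c) h).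
Qed.

Lemma strip_weight_integral_swap p s r c : 0 < p <= 1 -> 0 < s -> 0 < r ->
  (\int[@leb2 R]_z (strip_weight p s r c (z.2, z.1))%:E <= (8 * s `^ p * r)%:E)%E.
Proof.
move=> p01 s0 r0; have /andP[p0 p1] := p01.
have mF : measurable_fun (setT : set T2) (fun z : T2 => (strip_weight p s r c (z.2, z.1))%:E).
  by apply/measurable_EFinP; exact: measurable_strip_weight_swap.
have F0 (z : T2) : (0 <= (strip_weight p s r c (z.2, z.1))%:E)%E by rewrite lee_fin strip_weight_ge0.
rewrite (fubini_leb2 mF F0).
apply: (@le_trans _ _ (\int[mu]_y (4 * s `^ p * \1_(`[(c - r)%R, (c + r)%R]%classic) y)%:E)%E).
  apply: ge0_le_integral => //.
  - by move=> y _; apply: integral_ge0.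
  - have M := @measurable_fun_fubini_tonelli_F _ _ (measurableTypeR R) (measurableTypeR R)
      R mu _ mF F0.
    exact: M.
  - apply/measurable_EFinP; apply: measurable_funM; first exact: measurable_cst.
    exact: measurable_band.
  - by move=> y _; exact: strip_weight_row.
rewrite integral_band ?mulr_ge0 ?powR_ge0// lee_fin.
by rewrite le_eqVlt; apply/orP; left; apply/eqP; ring.
Qed.

(** Where [|z|^2 >= 1 / 2] one of the two real coordinates has modulus at least 1/2. The two terms
    treat these cases by horizontal and by vertical slicing, so that their sum dominates the density
    on the cap around [z0]. *)
Definition cap_weight p s r (z0 z : cplx R) : R :=
  strip_weight p s r z0.2 z + strip_weight p s r z0.1 (z.2, z.1).

Lemma cap_weight_ge0 p s r z0 z : 0 < p -> 0 <= cap_weight p s r z0 z.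
Proof. by move=> p0; rewrite addr_ge0// strip_weight_ge0. Qed.

Lemma measurable_cap_weight p s r z0 : measurable_fun (setT : set T2) (cap_weight p s r z0 : T2 -> R).
Proof.
by apply: measurable_funD; [exact: measurable_strip_weight|exact: measurable_strip_weight_swap].
Qed.

Lemma cap_weight_integral p s r z0 : 0 < p <= 1 -> 0 < s -> 0 < r ->
  (\int[@leb2 R]_z (cap_weight p s r z0 z)%:E <= (16 * s `^ p * r)%:E)%E.
Proof.
move=> p01 s0 r0; have /andP[p0 p1] := p01.
under eq_integral do rewrite EFinD.
rewrite ge0_integralD//.
- apply: (le_trans (leeD (strip_weight_integral _ p01 s0 r0) (strip_weight_integral_swap _ p01 s0 r0))).
  by rewrite -EFinD lee_fin le_eqVlt; apply/orP; left; apply/eqP; ring.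
- by move=> z _; rewrite lee_fin strip_weight_ge0.
- by apply/measurable_EFinP; exact: measurable_strip_weight.
- by move=> z _; rewrite lee_fin strip_weight_ge0.
- by apply/measurable_EFinP; exact: measurable_strip_weight_swap.
Qed.

Lemma dens_le_cap_weight beta s r (z0 z : cplx R) : -1 < beta -> disc z ->
  1 / 2 <= cabs z ^+ 2 -> 1 - cabs z ^+ 2 <= s -> `|z - z0| <= r ->
  dens_beta beta z <= cap_weight (beta + 1) s r z0 z.
Proof.
move=> b1 zD; have zq : cabs z ^+ 2 < 1.
  by rewrite -(expr1n _ 2) ltr_pXn2r ?nnegrE ?sqrtr_ge0.
move: zq; rewrite /dens_beta !sqr_cabs => zq z2 zs zr.
have p0 : 0 < beta + 1 by lra.
set v := (1 - _) `^ beta.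
have v0 : 0 <= v by exact: powR_ge0.
have -> : (beta + 1) / pi * v = pi^-1 * ((beta + 1) * v) by rewrite mulrAC mulrC.
have pi1 : (pi : R)^-1 <= 1.
  by rewrite invf_le1 ?pi_gt0//; have := @pi_ge2 R; lra.
have bv : 0 <= (beta + 1) * v by rewrite mulr_ge0// ltW.
apply: (@le_trans _ _ ((beta + 1) * v)); first by rewrite ler_piMl.
have [r1 r2] : `|z.1 - z0.1| <= r /\ `|z.2 - z0.2| <= r.
  move: zr; rewrite prod_normE /= ge_max => /andP[h1 h2]; split; [exact: h1|exact: h2].
have sq (x : R) : `|x| < 1 / 2 -> x ^+ 2 < 1 / 4.
  move=> h; rewrite -(real_normK (num_real x)) expr2.
  have -> : 1 / 4 = (1 / 2) * (1 / 2) :> R by field.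
  by rewrite ltr_pM.
have [x1|x1] := leP (1 / 2) `|z.1|.
  apply: (@le_trans _ _ (strip_weight (beta + 1) s r z0.2 z)); last first.
    by rewrite /cap_weight lerDl strip_weight_ge0.
  by rewrite /strip_weight indicE mem_set ?mulr1 /weight ?addrK.
have [y1|y1] := leP (1 / 2) `|z.2|; last first.
  by have := sq _ x1; have := sq _ y1; lra.
apply: (@le_trans _ _ (strip_weight (beta + 1) s r z0.1 (z.2, z.1))); last first.
  by rewrite /cap_weight lerDr strip_weight_ge0.
rewrite /strip_weight indicE mem_set ?mulr1 /weight ?addrK /=; last first.
  by split=> //=; rewrite [z.2 ^+ 2 + _]addrC.
by rewrite [z.2 ^+ 2 + _]addrC.
Qed.

Lemma dens_ge0 beta (z : cplx R) : -1 < beta -> 0 <= dens_beta beta z.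
Proof.
by move=> b1; rewrite mulr_ge0 ?powR_ge0// divr_ge0 ?pi_ge0//; lra.
Qed.

Lemma measurable_dens beta : measurable_fun (setT : set T2) (dens_beta beta : T2 -> R).
Proof.
have -> : (dens_beta beta : T2 -> R) = fun z => pi^-1 * weight (beta + 1) z.
  by apply/funext => z; rewrite /dens_beta /weight sqr_cabs addrK mulrA [pi^-1 * _]mulrC.
by apply: measurable_funM; [exact: measurable_cst|exact: measurable_weight].
Qed.


(** Replacing [K^t] by [K^3] makes the final constant independent of [beta]; the exponent used lies
    between 3/2 and 5/2. *)
Lemma powR_le_bound (K d t : R) : 1 <= K -> 0 < d -> 0 <= t <= 3 ->
  (K * d) `^ t <= K ^+ 3 * d `^ t.
Proof.
move=> K1 d0 /andP[t0 t3]; have K0 : 0 <= K by lra.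
rewrite powRM ?(ltW d0)// ler_wpM2r ?powR_ge0//.
by rewrite -powR_mulrn// ler_powR.
Qed.

Lemma powR_half_split (X t : R) : 0 < X ->
  16 * X * (16 * X `^ t * Num.sqrt X) = 256 * X `^ (1 + t + 2^-1).
Proof.
move=> X0; have X1 : X != 0 by rewrite gt_eqF.
rewrite [X `^ (1 + t + _)]powRD ?X1 ?implybT// [X `^ (1 + t)]powRD ?X1 ?implybT//.
by rewrite powRr1 ?(ltW X0)// powR12_sqrt ?(ltW X0)//; ring.
Qed.

(* Slicing in z1: the slice sits in a ball of radius Kd, over a base contained in a cap
   of depth Kd and width sqrt(Kd). *)
Lemma V_beta_le (beta K d : R) (S : set (cplx2 R)) : -1 < beta <= 0 -> 1 <= K -> 0 < d ->
  open S ->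
  (forall z, S z -> bidisc z /\ (1 / 2 <= cabs z.1 ^+ 2 /\ 1 / 2 <= cabs z.2 ^+ 2)) ->
  (forall z z' : cplx2 R, S z -> S z' -> [/\ 1 - cabs z.1 ^+ 2 <= K * d, `|z.1 - z'.1| ^+ 2 <= K * d
      & z.1 = z'.1 -> `|z.2 - z'.2| <= K * d]) ->
  (V_beta beta S <= (256 * K ^+ 3 * d `^ (2 + beta + 2^-1))%:E)%E.
Proof.
move=> /andP[b1 b2] K1 d0 oS Sb Sg.
(* A point of [S] is needed as the centre of the cap in the first variable. *)
have [->|S0] := eqVneq S set0.
  rewrite /V_beta integral_set0 lee_fin; apply: mulr_ge0; last exact: powR_ge0.
  by apply: mulr_ge0 => //; apply: exprn_ge0; lra.
move/set0P: S0 => [z0 Sz0].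
pose p := beta + 1; have p0 : 0 < p by rewrite /p; lra.
have p01 : 0 < p <= 1 by rewrite p0 /p; lra.
have s0 : 0 < K * d by rewrite mulr_gt0//; lra.
have r0 : 0 < Num.sqrt (K * d) by rewrite sqrtr_gt0.
have mS : @measurable _ (T2 * T2)%type S by exact: open_measurable_cplx2.
pose D (z : cplx2 R) : \bar R := (dens_beta beta z.1 * dens_beta beta z.2)%:E.
have mD : measurable_fun (setT : set (T2 * T2)) (D : T2 * T2 -> \bar R).
  apply/measurable_EFinP; apply: measurable_funM.
    exact: (measurableT_comp (measurable_dens beta) measurable_fst).
  exact: (measurableT_comp (measurable_dens beta) measurable_snd).
have mDS : measurable_fun (setT : set (T2 * T2)) ((D \_ S) : T2 * T2 -> \bar R).
  by apply/(measurable_restrictT (D : T2 * T2 -> \bar R) mS); exact: measurable_funTS.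
have D0 z : (0 <= D z)%E by rewrite lee_fin mulr_ge0// dens_ge0.
have DS0 z : (0 <= (D \_ S) z)%E by rewrite patchE; case: ifP.
rewrite /V_beta integral_mkcond -/D (fubini_leb4 mDS DS0).
pose H (z : T2) : R := cap_weight p (K * d) (Num.sqrt (K * d)) z0.1 z.
have H0 z : 0 <= H z by exact: cap_weight_ge0.
have mH : measurable_fun setT H by exact: measurable_cap_weight.
apply: (@le_trans _ _ (\int[@leb2 R]_z1 ((16 * (K * d))%:E * (H z1)%:E))%E).
  apply: ge0_le_integral => //.
  - by move=> z _; apply: integral_ge0.
  - have M := @measurable_fun_fubini_tonelli_F _ _ T2 T2 R (@leb2 R) _ mDS DS0; exact: M.
  - by apply/measurable_EFinP; apply: measurable_funM; first exact: measurable_cst.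
  move=> z1 _.
  have [[z2 S12]|noS] := pselect (exists z2, S (z1, z2)); last first.
    rewrite integral0_eq.
      by rewrite -EFinM lee_fin mulr_ge0// mulr_ge0//; lra.
    move=> z2 _; rewrite patchE memNset// => h; apply: noS; by exists z2.
  (* Depth 1 is no restriction in the disc and contributes [1^p = 1], so the slice around its point
     [z2] costs only its radius: [16 (K d)], whatever [beta]. *)
  pose H' (z : T2) : R := cap_weight p 1 (K * d) z2 z.
  have mH' : measurable_fun setT H' by exact: measurable_cap_weight.
  have H'0 z : 0 <= H' z by exact: cap_weight_ge0.
  have [z1B [z1h z2h]] := Sb _ S12.
  have z1H : dens_beta beta z1 <= H z1.
    have [g1 g2 _] := Sg _ _ S12 Sz0.
    apply: dens_le_cap_weight => //; first exact: z1B.1.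
    rewrite -(@ler_pXn2r _ 2) ?nnegrE ?sqrtr_ge0// sqr_sqrtr ?(ltW s0)//.
  apply: (@le_trans _ _ (\int[@leb2 R]_z ((dens_beta beta z1)%:E * (H' z)%:E))%E).
    apply: ge0_le_integral => //.
    - exact: (measurableT_comp mDS (@pair1_measurable _ _ T2 T2 z1)).
    - by apply/measurable_EFinP; apply: measurable_funM; first exact: measurable_cst.
    move=> z _; rewrite patchE; case: ifPn => [|_]; last first.
      by rewrite -EFinM lee_fin mulr_ge0// dens_ge0.
    rewrite inE => Sz; have [zB [_ zh]] := Sb _ Sz.
    rewrite -EFinM lee_fin ler_wpM2l ?dens_ge0//.
    have [_ _ g3] := Sg _ _ Sz S12.
    apply: dens_le_cap_weight => //; [exact: zB.2|have := sqr_ge0 (cabs z); move: zh => /=; lra|exact: g3].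
  have H'e z : setT z -> (0 <= (H' z)%:E)%E by rewrite lee_fin.
  have mH'e : measurable_fun setT (fun z => (H' z)%:E) by apply/measurable_EFinP.
  rewrite (ge0_integralZl_EFin (@leb2 R) measurableT H'e mH'e (dens_ge0 z1 b1)).
  have I := cap_weight_integral z2 p01 ltr01 s0; rewrite powR1 mulr1 in I.
  apply: (@le_trans _ _ ((dens_beta beta z1)%:E * (16 * (K * d))%:E)%E).
    by apply: lee_wpmul2l => //; rewrite lee_fin dens_ge0.
  by rewrite -!EFinM lee_fin mulrC ler_wpM2l// mulr_ge0//; lra.
have k0 : 0 <= 16 * (K * d) by rewrite mulr_ge0// ltW.
have He z : setT z -> (0 <= (H z)%:E)%E by rewrite lee_fin.
have mHe : measurable_fun setT (fun z => (H z)%:E) by apply/measurable_EFinP.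
rewrite (ge0_integralZl_EFin (@leb2 R) measurableT He mHe k0).
have I := cap_weight_integral z0.1 p01 s0 r0.
apply: (@le_trans _ _ ((16 * (K * d))%:E * (16 * (K * d) `^ p * Num.sqrt (K * d))%:E)%E).
  by apply: lee_wpmul2l; rewrite ?lee_fin.
rewrite -EFinM lee_fin.
(* The slice gives exponent 1, the depth of the base [p = beta + 1], and its width 1/2. *)
have -> : 16 * (K * d) * (16 * (K * d) `^ p * Num.sqrt (K * d)) = 256 * (K * d) `^ (2 + beta + 2^-1).
  have -> : 2 + beta + 2^-1 = (1 + p) + 2^-1 by rewrite /p; ring.
  exact: powR_half_split.
rewrite -mulrA ler_pM2l// powR_le_bound//; apply/andP; split; lra.
Qed.


End Final.

Theorem mainTheorem14 (R : realType) (phi : cplx2 R -> cplx R) (a1 a2 : R) :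
  holomorphic_on (@bidisc R) phi ->
  (forall z, bidisc z -> disc (phi z)) ->
  Ck_up_to_boundary 3 phi ->
  circle (phi (expi a1, expi a2)) ->
  truly_2d_order2 phi a1 a2 ->
  exists U : set (cplx2 R), nbhs ((expi a1, expi a2) : cplx2 R) U /\
  exists C : R, 0 < C /\
    forall (beta : R) (eta : cplx R) (delta : R),
      -1 < beta <= 0 -> circle eta -> 0 < delta ->
      (V_beta beta [set z | bidisc z /\ U z /\ (cabs (csub (phi z) eta) < delta)%R]
        <= (C * delta `^ (2 + beta + 2^-1))%:E)%E.
Proof.
move=> hol phi_disc [F [sF Fphi]] hxi h2d.
have Fphi' (z : cplx2 R) : cl_bidisc z -> F z = phi z by move=> h; apply: Fphi; exact: mem_set.
have bcl (z : cplx2 R) : bidisc z -> cl_bidisc z by move=> [h1 h2]; split; exact: ltW.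
have [U [K [oU Uxi K1 Uhalf geo]]] :=
  bidisc_geometry hol phi_disc (smoothW sF) Fphi' hxi h2d.
exists U; split; first exact: open_nbhs_nbhs.
exists (256 * K ^+ 3); split; first by rewrite mulr_gt0// exprn_gt0//; lra.
move=> beta eta delta hb heta d0.
(* Inside the bidisc [phi] may be replaced by its extension [F], whose continuity on the whole space
   makes the set open, hence measurable. *)
have -> : [set z | bidisc z /\ U z /\ cabs (csub (phi z) eta) < delta] =
    @bidisc R `&` U `&` [set z | cabs (csub (F z) eta) < delta].
  apply/seteqP; split=> z /=.
    by move=> [zB [zU h]]; split; [split|rewrite (Fphi' _ (bcl _ zB))].
  by move=> [[zB zU] h]; split=> //; split=> //; rewrite -(Fphi' _ (bcl _ zB)).
apply: V_beta_le => //.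
- apply: openI; first by apply: openI => //; exact: bidisc_open.
  have cF : continuous F := smooth_continuous sF.
  apply: (@open_comp _ _ (fun z => cabs (csub (F z) eta)) [set x | x < delta]) => [z _|]; last exact: open_lt.
  apply: (@continuous_comp _ _ _ (fun z => csub (F z) eta) (@cabs R)); last exact: continuous_cabs.
  have c1 : (F y).1 @[y --> z] --> (F z).1 by apply: (cvg_comp _ _ (cF z)); exact: cvg_fst.
  have c2 : (F y).2 @[y --> z] --> (F z).2 by apply: (cvg_comp _ _ (cF z)); exact: cvg_snd.
  have e1 : (F y).1 - eta.1 @[y --> z] --> (F z).1 - eta.1 by apply: cvgB => //; exact: cvg_cst.
  have e2 : (F y).2 - eta.2 @[y --> z] --> (F z).2 - eta.2 by apply: cvgB => //; exact: cvg_cst.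
  exact: (cvg_pair e1 e2).
- by move=> z [[zB zU] _]; split=> //; exact: Uhalf.
- move=> z z' [[zB zU] h] [[zB' zU'] h'].
  apply: (geo eta) => //; first by rewrite -(Fphi' _ (bcl _ zB)).
  by rewrite -(Fphi' _ (bcl _ zB')).
Qed.
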